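(* Let $p$ be a prime. There exists a finitely generated Engel branch $p$-group $G_p$. In particular, $G_p$ is not nilpotent. Furthermore, if $p$ is odd, the group $G_p$ is contained in a two-generated non-nilpotent Engel group.
   Context: Commutators: $[x,y]=x^{-1}y^{-1}xy$, $[g,_0 h]=g$ and $[g,_{n+1}h]=[[g,_n h],h]$. A group $G$ is an Engel group if for all $g,h\in G$ there is $n\in\mathbb N=\{0,1,2,\dots\}$ with $[g,_n h]=\mathrm{id}$. Rooted trees: let $\mathcal X=(X_n)_{n\in\mathbb N}$ be a sequence of finite sets of cardinality at least $2$. The (spherically homogeneous) rooted tree $\mathcal T_{\mathcal X}$ has as vertices all finite strings whose $i$-th letter (counting from $0$) lies in $X_i$, including the empty string (the root); two strings are joined by an edge if one is obtained from the other by appending one letter at the end. $\mathcal L(n)$ denotes the set of strings of length $n$. $\mathrm{Aut}(\mathcal T_{\mathcal X})$ is the group of root-preserving graph automorphisms, acting on the right, $u\mapsto u.g$. For a string $u$ of length $n$ the section $g|_u\in \mathrm{Aut}(\mathcal T_{(X_m)_{m\ge n}})$ is defined by $(uv).g=(u.g)(v.(g|_u))$. Branch groups: let $G\le\mathrm{Aut}(\mathcal T_{\mathcal X})$. $\mathrm{St}_G(n)$ is the pointwise stabiliser of $\mathcal L(n)$. For $u\in\mathcal L(n)$, the rigid stabiliser of $u$ is $\{g\in \mathrm{St}_G(n): g|_v=\mathrm{id}\text{ for all }v\in\mathcal L(n),\ v\ne u\}$, and the $n$-th rigid layer stabiliser $\mathrm{Rist}_G(n)$ is the subgroup generated by the rigid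 stabilisers of all $u\in\mathcal L(n)$. $G$ is spherically transitive if it acts transitively on every $\mathcal L(n)$, and $G$ is a branch group if it is spherically transitive and $\mathrm{Rist}_G(n)$ has finite index in $G$ for every $n$. *)

(* Defs.v *)
From HB Require Import structures.
From mathcomp Require Import all_boot.
From mathcomp Require Import boolp classical_sets cardinality.

Set Implicit Arguments.
Unset Strict Implicit.
Unset Printing Implicit Defensive.

Local Open Scope classical_set_scope.
Local Open Scope group_scope.

(* Subgroups of a (possibly infinite) group are handled as sets of elements
   closed under the group operations; statements about a whole group [gT] are
   obtained by taking [G := [set: gT]]. *)

Section Groups.
Variable gT : groupType.
Implicit Types (G H S : set gT) (g h : gT).

Definition subgroup G : Prop :=
  [/\ G 1, forall g h, G g -> G h -> G (g * h) & forall g, G g -> G g^-1].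

Definition generated S : set gT := smallest subgroup S.

Definition finitely_generated G : Prop :=
  exists s : seq gT, G = generated [set` s].

Definition two_generated G : Prop :=
  exists a b : gT, G = generated [set a; b].

Definition is_order g (n : nat) : Prop :=
  [/\ (0 < n)%N, g ^+ n = 1 &
      forall m : nat, (0 < m)%N -> g ^+ m = 1 -> (n <= m)%N].

Definition p_group (p : nat) G : Prop :=
  forall g, G g -> exists k : nat, is_order g (p ^ k)%N.

Fixpoint iter_comm g h (n : nat) : gT :=
  if n is n'.+1 then [~ iter_comm g h n', h] else g.

Definition Engel G : Prop :=
  forall g h, G g -> G h -> exists n : nat, iter_comm g h n = 1.

Definition comm_subgroup G H : set gT :=
  generated [set c | exists g h, [/\ G g, H h & c = [~ g, h]]].

(* [lower_central G n] is the term usually written gamma_(n+1)(G). *)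
Fixpoint lower_central G (n : nat) : set gT :=
  if n is n'.+1 then comm_subgroup (lower_central G n') G else G.

Definition nilpotent G : Prop := exists c : nat, lower_central G c = [set 1].

Definition right_coset H g : set gT := [set h * g | h in H].

Definition finite_index H G : Prop :=
  finite_set [set right_coset H g | g in G].

End Groups.

(* [embeds G hT]: the subgroup [G] is isomorphic to a subgroup of [hT]; the
   values of [f] outside [G] are irrelevant. *)
Definition embeds (gT : groupType) (G : set gT) (hT : groupType) : Prop :=
  exists f : gT -> hT,
    (forall x y, G x -> G y -> f (x * y) = f x * f y) /\
    (forall x y, G x -> G y -> f x = f y -> x = y).

Definition shift (n : nat) (X : nat -> finType) : nat -> finType :=
  fun m => X (n + m)%N.

(* The strings whose i-th letter lies in [X i]. *)
Inductive vertex (X : nat -> finType) : Type :=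
| Root
| Cons of X 0%N & vertex (shift 1 X).

Arguments Root {X}.
Arguments Cons {X} _ _.

Fixpoint vsize X (u : vertex X) : nat :=
  if u is Cons _ u' then (vsize u').+1 else 0%N.

(* [vrcons u x] is [u] with the letter [x] appended at the end. *)
Fixpoint vrcons X (u : vertex X) : X (vsize u) -> vertex X :=
  match u return X (vsize u) -> vertex X with
  | Root => fun x => Cons x Root
  | Cons y u' => fun x => Cons y (@vrcons _ u' x)
  end.

(* [vcat n u v] is the concatenation uv, when [u] has length [n]. Indexing by
   [n] rather than by [vsize u] avoids casts between shifted trees. *)
Fixpoint vcat (n : nat) X (u : vertex X) : vertex (shift n X) -> vertex X :=
  match n return vertex (shift n X) -> vertex X with
  | 0%N => fun v => v
  | n'.+1 => fun v => if u is Cons x u' then Cons x (@vcat n' _ u' v) else Root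
  end.

Fixpoint vdrop (n : nat) X (u : vertex X) : vertex (shift n X) :=
  match n return vertex (shift n X) with
  | 0%N => u
  | n'.+1 => if u is Cons _ u' then @vdrop n' _ u' else Root
  end.

Fixpoint vtake (n : nat) X (u : vertex X) : vertex X :=
  match n, u with
  | n'.+1, Cons x u' => Cons x (@vtake n' _ u')
  | _, _ => Root
  end.

Definition child X (u v : vertex X) : Prop := exists x, v = @vrcons X u x.
Definition adjacent X (u v : vertex X) : Prop := child u v \/ child v u.

Definition level X (n : nat) : Type := {u : vertex X | vsize u == n}.

Record aut (X : nat -> finType) : Type := Aut {
  aut_fun :> vertex X -> vertex X;
  aut_inv : vertex X -> vertex X;
  aut_funK : cancel aut_fun aut_inv;
  aut_invK : cancel aut_inv aut_fun;
  aut_root : aut_fun Root = Root;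
  aut_adj : forall u v, adjacent (aut_fun u) (aut_fun v) <-> adjacent u v
}.

Section AutGroup.
Variable X : nat -> finType.
Implicit Types g h : aut X.

Lemma autP g h : g =1 h -> g = h.
Proof.
case: g h => [f fi fK fiK fr fa] [k ki kK kiK kr ka] /= /funext E.
subst k.
have Ei : fi = ki by apply: funext => u; rewrite -{1}(kiK u) fK.
subst ki; congr Aut; exact: Prop_irrelevance.
Qed.

Fact aut_one_adj (u v : vertex X) : adjacent (id u) (id v) <-> adjacent u v.
Proof. by []. Qed.
Definition aut_one : aut X :=
  @Aut X id id (fun _ => erefl) (fun _ => erefl) erefl aut_one_adj.

Fact aut_inv_root g : aut_inv g Root = Root.
Proof. by rewrite -{1}(aut_root g) aut_funK. Qed.
Fact aut_inv_adj g u v :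
  adjacent (aut_inv g u) (aut_inv g v) <-> adjacent u v.
Proof. by rewrite -(aut_adj g) !aut_invK. Qed.
Definition aut_opp g : aut X :=
  Aut (aut_invK g) (aut_funK g) (aut_inv_root g) (aut_inv_adj g).

Fact aut_mul_funK g h : cancel (h \o g) (aut_inv g \o aut_inv h).
Proof. exact: can_comp (aut_funK h) (aut_funK g). Qed.
Fact aut_mul_invK g h : cancel (aut_inv g \o aut_inv h) (h \o g).
Proof. exact: can_comp (aut_invK g) (aut_invK h). Qed.
Fact aut_mul_root g h : (h \o g) Root = Root.
Proof. by rewrite /= !aut_root. Qed.
Fact aut_mul_adj g h u v :
  adjacent ((h \o g) u) ((h \o g) v) <-> adjacent u v.
Proof. by rewrite /= !aut_adj. Qed.

(* Automorphisms act on the right, so [g u] stands for u.g and the product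
   g * h is "first g, then h". *)
Definition aut_mul g h : aut X :=
  Aut (@aut_mul_funK g h) (@aut_mul_invK g h) (aut_mul_root g h)
      (aut_mul_adj g h).

HB.instance Definition _ := gen_eqMixin (aut X).
HB.instance Definition _ := gen_choiceMixin (aut X).

Fact aut_mulA : associative aut_mul.
Proof. by move=> f g h; apply: autP. Qed.
Fact aut_mul1 : left_id aut_one aut_mul.
Proof. by move=> f; apply: autP. Qed.
Fact aut_1mul : right_id aut_one aut_mul.
Proof. by move=> f; apply: autP. Qed.
Fact aut_mulV : left_inverse aut_one aut_opp aut_mul.
Proof. by move=> f; apply: autP => u /=; rewrite aut_invK. Qed.
Fact aut_Vmul : right_inverse aut_one aut_opp aut_mul.
Proof. by move=> f; apply: autP => u /=; rewrite aut_funK. Qed.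

HB.instance Definition _ :=
  isGroup.Build (aut X) aut_mulA aut_mul1 aut_1mul aut_mulV aut_Vmul.

End AutGroup.

Lemma vsize_child X (u v : vertex X) : child u v -> vsize v = (vsize u).+1.
Proof.
case=> x -> {v}; elim: u x => //= Y y u IH x.
by rewrite IH.
Qed.

Lemma vertex_rcons X (v : vertex X) : v = Root \/ exists u, child u v.
Proof.
elim: v => [|Y x v IH]; first by left.
right; case: IH => [->|[u [y ->]]]; first by exists Root, x.
by exists (Cons x u), y.
Qed.

Lemma vertex_child_ind X (P : vertex X -> Prop) :
  P Root -> (forall u v, child u v -> P u -> P v) -> forall v, P v.
Proof.
move=> P0 PS v; move: {2}(vsize v) (erefl (vsize v)) => n.
elim: n v => [|n IH] v Hv; case: (vertex_rcons v) => [->//|[u uv]];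
  have := vsize_child uv; rewrite Hv // => -[Hu].
by apply: PS uv _; apply: IH.
Qed.

Lemma vsize_vcat n X (u : vertex X) v :
  vsize u = n -> vsize (vcat (n := n) u v) = (n + vsize v)%N.
Proof. by elim: n X u v => [|n IH] X [|x u] v //= [/IH->]. Qed.

Lemma vtake_vcat n X (u : vertex X) v :
  vsize u = n -> vtake n (vcat (n := n) u v) = u.
Proof. by elim: n X u v => [|n IH] X [|x u] v //= [/IH->]. Qed.

Lemma vdrop_vcat n X (u : vertex X) v :
  vsize u = n -> vdrop n (vcat (n := n) u v) = v.
Proof. by elim: n X u v => [|n IH] X [|x u] v //= [/IH->]. Qed.

Lemma vcat_take_drop n X (u : vertex X) :
  (n <= vsize u)%N -> vcat (vtake n u) (vdrop n u) = u.
Proof. by elim: n X u => [|n IH] X [|x u] //= Hu; rewrite IH. Qed.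

Lemma vtake_child n X (u v : vertex X) :
  (n <= vsize u)%N -> child u v -> vtake n v = vtake n u.
Proof.
move=> + [x ->] {v}; elim: n X u x => [|n IH] X [|y u] x //= Hu.
by rewrite IH.
Qed.

Lemma vdrop_child n X (u v : vertex X) :
  (n <= vsize u)%N -> child u v -> child (vdrop n u) (vdrop n v).
Proof.
move=> + [x ->] {v}; elim: n X u x => [|n IH] X u x /=; first by exists x.
by case: u x => //= y u x Hu; apply: IH.
Qed.

Lemma vcat_child n X (u : vertex X) v w :
  vsize u = n -> child v w -> child (vcat (n := n) u v) (vcat (n := n) u w).
Proof.
move=> + vw; elim: n X u v w vw => [|n IH] X [|x u] v w vw //= [Hu].
have [y Hy] := IH _ u v w vw Hu.
by rewrite Hy; exists y.
Qed.

Lemma vcat_Root n X (u : vertex X) : vsize u = n -> vcat (n := n) u Root = u.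
Proof. by elim: n X u => [|n IH] X [|x u] //= [/IH->]. Qed.

Lemma vtake_size n X (u : vertex X) : vsize u = n -> vtake n u = u.
Proof. by elim: n X u => [|n IH] X [|x u] //= [/IH->]. Qed.

Section Sections.
Variable X : nat -> finType.
Implicit Types g : aut X.

Lemma leq_vsize_aut g u : (vsize (g u) <= vsize u)%N.
Proof.
elim/vertex_child_ind: u => [|u v uv IH]; first by rewrite aut_root.
rewrite (vsize_child uv).
have [/vsize_child->//|/vsize_child E] : adjacent (g u) (g v).
  by apply/aut_adj; left.
by move: IH; rewrite E => /ltnW/leqW.
Qed.

Lemma vsize_aut g u : vsize (g u) = vsize u.
Proof.
apply/eqP; rewrite eqn_leq leq_vsize_aut /= -{1}(aut_funK g u).
exact: (leq_vsize_aut (aut_opp g)).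
Qed.

Lemma child_aut g u v : child u v -> child (g u) (g v).
Proof.
move=> uv; have [//|/vsize_child] : adjacent (g u) (g v).
  by apply/aut_adj; left.
rewrite !vsize_aut (vsize_child uv).
by elim: (vsize u) => // n IH [/IH].
Qed.

Lemma vtake_aut n g u v :
  vsize u = n -> vtake n (g (vcat (n := n) u v)) = g u.
Proof.
move=> Hu; elim/vertex_child_ind: v => [|v w vw IH].
  by rewrite vcat_Root // vtake_size // vsize_aut.
rewrite -IH; apply: vtake_child; last exact/child_aut/vcat_child.
by rewrite vsize_aut vsize_vcat // leq_addr.
Qed.

Fact level_aut_subproof n g (u : level X n) : vsize (g (val u)) == n.
Proof. by rewrite vsize_aut; apply: valP u. Qed.
Definition level_aut n g (u : level X n) : level X n :=
  exist _ (g (val u)) (level_aut_subproof g u).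

Section AtVertex.
Variables (n : nat) (g : aut X) (u : level X n).

Definition section_fun (v : vertex (shift n X)) : vertex (shift n X) :=
  vdrop n (g (vcat (val u) v)).

(* The defining property of sections: (uv).g = (u.g)(v.(g|_u)). *)
Lemma section_funE v :
  g (vcat (val u) v) = vcat (g (val u)) (section_fun v).
Proof.
have /eqP Hu := valP u.
rewrite -(vtake_aut g v Hu) vcat_take_drop // vsize_aut vsize_vcat //.
exact: leq_addr.
Qed.

End AtVertex.

Lemma section_funK n g (u : level X n) :
  cancel (section_fun g u) (section_fun (aut_opp g) (level_aut g u)).
Proof.
move=> v; rewrite {1}/section_fun /= -section_funE aut_funK vdrop_vcat //.
exact/eqP/(valP u).
Qed.

Lemma section_invK n g (u : level X n) :
  cancel (section_fun (aut_opp g) (level_aut g u)) (section_fun g u).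
Proof.
move=> v; have /eqP Hu := valP (level_aut g u).
have := section_funE (aut_opp g) (level_aut g u) v.
rewrite /= aut_funK {2}/section_fun => <-.
by rewrite aut_invK vdrop_vcat.
Qed.

Lemma section_root n g (u : level X n) : section_fun g u Root = Root.
Proof.
have /eqP Hu := valP u.
have Hg : vsize (g (val u)) = n by rewrite vsize_aut.
by have := vdrop_vcat Root Hg; rewrite /section_fun !vcat_Root.
Qed.

Lemma section_child n g (u : level X n) v w :
  child v w -> child (section_fun g u v) (section_fun g u w).
Proof.
have /eqP Hu := valP u => vw; apply: vdrop_child.
  by rewrite vsize_aut vsize_vcat // leq_addr.
exact/child_aut/vcat_child.
Qed.

Lemma section_adj n g (u : level X n) v w :
  adjacent (section_fun g u v) (section_fun g u w) <-> adjacent v w.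
Proof.
split=> [|[]] vw; [|left|right]; try exact: section_child.
rewrite -(section_funK g u v) -(section_funK g u w).
by case: vw => vw; [left|right]; apply: section_child.
Qed.

Definition section n g (u : level X n) : aut (shift n X) :=
  Aut (section_funK g u) (section_invK g u) (section_root g u)
      (section_adj g u).

End Sections.

Section Branch.
Variable X : nat -> finType.
Implicit Types G : set (aut X).

Definition stabiliser G (n : nat) : set (aut X) :=
  [set g | G g /\ forall u : level X n, g (val u) = val u].

Definition rigid_stabiliser G (n : nat) (u : level X n) : set (aut X) :=
  [set g | stabiliser G n g /\
           forall v : level X n, v <> u -> section g v = 1].

Definition rigid_layer_stabiliser G (n : nat) : set (aut X) :=
  generated (\bigcup_(u in [set: level X n]) rigid_stabiliser G u).

Definition spherically_transitive G : Prop :=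
  forall (n : nat) (u v : level X n), exists g, G g /\ g (val u) = val v.

Definition branch G : Prop :=
  spherically_transitive G /\
  forall n : nat, finite_index (rigid_layer_stabiliser G n) G.

End Branch.

(* Main.v *)
(* The n-th level X_n is a finite abelian p-group A_n acting on itself by
   translations, and the group is generated by the translations of the first
   level and one directed automorphism b, whose section at 0 is the next copy of
   b, whose section at a "position" x_i of A_n is the i-th generator e_i of
   A_(n+1), and whose other sections are trivial.

   Branching: the positions are sum-free, so b and its conjugate by x_i have
   only the vertex 0 in common in their supports, and their commutator is
   [b, e_i] placed at 0.  Hence the derived subgroup G' contains a copy of G_1'
   at each vertex of the first level, where G_1 is the group one level down, and
   G/G' is finite.

   Engel property: the positions are codewords at pairwise distance m_n.
   Elements of bounded length, restricted to one orbit of h, therefore have at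
   level n+1 sections in one common cyclic group <b> or <e_i>.  Along such an
   orbit g -> [g, h] acts as T - 1 with T^(p^r) = 1, which is nilpotent modulo
   p^t.  The same remark, applied to the abelian groups A_0, ..., A_n, first
   brings [g,_N h] into the stabiliser of level n+1, with N depending on n but
   not on m_n; so it suffices that m_n grows fast with n.

   Only A_1, A_2, ... need the large rank that the code requires: A_0 can be
   cyclic, so the group is generated by two elements and is its own
   two-generated overgroup, for every p. *)
From HB Require Import structures.
From mathcomp Require Import all_boot all_algebra.
From mathcomp Require Import boolp classical_sets cardinality.
From mathcomp Require Import zify.
Require Import Defs.

Set Implicit Arguments.
Unset Strict Implicit.
Unset Printing Implicit Defensive.

Import GRing.Theory.
Local Open Scope classical_set_scope.
Local Open Scope group_scope.

(** * Generated subgroups and commutator identities *)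

Section Generated.
Variable gT : groupType.
Implicit Types (S H : set gT) (x y z : gT).

Lemma generated_subgroup S : subgroup (generated S).
Proof.
split=> [H [[]] //|g h Hg Hh H HS|g Hg H HS].
  by have [[_ HM _] _] := HS; apply: HM; [apply: Hg | apply: Hh].
by have [[_ _ HV] _] := HS; apply: HV; apply: Hg.
Qed.

Lemma generated_sub S : S `<=` generated S.
Proof. by move=> g Sg H [_]; apply. Qed.

Lemma generated_min S H : subgroup H -> S `<=` H -> generated S `<=` H.
Proof. by move=> HH SH g; apply. Qed.

Lemma subgroup_conj H y : subgroup H -> subgroup [set x | H (x ^ y)].
Proof.
case=> [H1 HM HV]; split=> /= [|g h|g]; rewrite ?conj1g ?conjMg ?conjVg //.
- exact: HM.
- exact: HV.
Qed.

Lemma commMgJ x y z : [~ x * y, z] = [~ x, z] ^ y * [~ y, z].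
Proof. by rewrite !commgEr conjgM mulgA -conjMg mulgK. Qed.

Lemma commgMJ x y z : [~ x, y * z] = [~ x, z] * [~ x, y] ^ z.
Proof. by rewrite !commgEl conjgM -mulgA -conjMg mulVKg. Qed.

Lemma subgroup_comm H x y : subgroup H -> H x -> H y -> H [~ x, y].
Proof.
move=> [_ HM HV] Hx Hy; rewrite commgEl conjgE.
by apply: (HM); [apply: HV | apply: (HM); [apply: HV | apply: HM]].
Qed.

Lemma lower_central_subgroup H n : subgroup H -> subgroup (lower_central H n).
Proof. by case: n => // n _; apply: generated_subgroup. Qed.

Lemma lower_central_sub H n : subgroup H -> lower_central H n `<=` H.
Proof.
move=> HH; elim: n => // n IH; apply: generated_min => // _ [g [h [/IH Hg Hh ->]]].
exact: subgroup_comm.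
Qed.

End Generated.

(** * Tree automorphisms and their sections *)

Section AutOfMaps.
Variable X : nat -> finType.

Lemma child_Cons (y : X 0) (u v : vertex (shift 1 X)) :
  child u v -> child (Cons y u) (Cons y v).
Proof. by case=> x ->; exists x. Qed.

Lemma child_Root (y : X 0) : child Root (Cons y Root).
Proof. by exists y. Qed.

Lemma childE (u v : vertex X) : child u v ->
  (u = Root /\ exists y, v = Cons y Root) \/
  (exists y u' v', [/\ u = Cons y u', v = Cons y v' & child u' v']).
Proof.
case: u => [|y u] [x ->]; first by left; split=> //; exists x.
by right; exists y, u, (vrcons (u := u) x); split=> //; exists x.
Qed.

Section Mk.
Variables f fi : vertex X -> vertex X.
Hypotheses (fK : cancel f fi) (fiK : cancel fi f) (f0 : f Root = Root).
Hypotheses (fc : forall u v, child u v -> child (f u) (f v)).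
Hypotheses (fic : forall u v, child u v -> child (fi u) (fi v)).

Fact aut_of_adj u v : adjacent (f u) (f v) <-> adjacent u v.
Proof.
split; first by case=> /fic; rewrite !fK; [left|right].
by case=> /fc; [left|right].
Qed.

Definition aut_of : aut X := Aut fK fiK f0 aut_of_adj.
End Mk.

Lemma aut1E (v : vertex X) : (1 : aut X) v = v. Proof. by []. Qed.
Lemma autME (g h : aut X) v : (g * h) v = h (g v). Proof. by []. Qed.
Lemma autKV (g : aut X) v : g^-1 (g v) = v. Proof. exact: (aut_funK g). Qed.
Lemma autVK (g : aut X) v : g (g^-1 v) = v. Proof. exact: (aut_invK g). Qed.

Fact lev1_subproof (y : X 0) : vsize (Cons y (@Root (shift 1 X))) == 1%N.
Proof. by []. Qed.
Definition lev1 (y : X 0) : level X 1 := exist _ (Cons y Root) (lev1_subproof y).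
Definition sec1 (g : aut X) (y : X 0) : aut (shift 1 X) := section g (lev1 y).

Lemma sec1E (g : aut X) y v :
  exists z, g (Cons y v) = Cons z (sec1 g y v) /\ g (Cons y Root) = Cons z Root.
Proof.
have := section_funE g (lev1 y) v => /=.
have := vsize_aut g (Cons y Root).
by case: (g (Cons y Root)) => [|z [|? ?]] //= _ ->; exists z.
Qed.

Lemma sec1_def (g : aut X) (y z : X 0) (h : aut (shift 1 X)) :
  (forall v, g (Cons y v) = Cons z (h v)) -> sec1 g y = h.
Proof.
move=> H; apply: autP => v; have [z' []] := sec1E g y v.
by rewrite H => -[_ ->].
Qed.

End AutOfMaps.

Section LevelSections.

Lemma level0E (X : nat -> finType) (u : level X 0) : val u = Root.
Proof. by case: u => -[|y u]. Qed.

Definition lcons (X : nat -> finType) n (y : X 0) (u : level (shift 1 X) n) : level X n.+1 :=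
  exist (fun v : vertex X => vsize v == n.+1) (Cons y (val u)) (valP u).

Lemma val_lcons (X : nat -> finType) n (y : X 0) (u : level (shift 1 X) n) :
  val (lcons y u) = Cons y (val u).
Proof. by []. Qed.

Lemma lconsP (X : nat -> finType) n (u : level X n.+1) : exists y v, u = @lcons X n y v.
Proof.
case: u => -[|y u] //= Hu; exists y, (exist _ u Hu).
exact: val_inj.
Qed.

Lemma section_lcons (X : nat -> finType) n (g : aut X) y (u : level (shift 1 X) n) :
  section g (lcons y u) = section (sec1 g y) u :> aut (shift n.+1 X).
Proof.
apply: autP => v.
set t : vertex (shift 1 X) := vcat (val u) v.
change (vdrop n.+1 (g (Cons y t)) = vdrop n (vdrop 1 (g (Cons y t)))).
by case: (g _) => [|z w] //; case: n {u v t}.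
Qed.

Lemma section0 X (g : aut X) (u : level X 0) : section g u = g :> aut X.
Proof. by apply: autP => v. Qed.

Lemma vsize_vtake n (X : nat -> finType) (v : vertex X) :
  (n <= vsize v)%N -> vsize (vtake n v) = n.
Proof. by elim: n X v => [|n IH] X [|y v] //= /IH->. Qed.

Variable X : nat -> finType.

Lemma section_aut n (g : aut X) (u : level X n) v :
  g (vcat (val u) v) = vcat (val (level_aut g u)) (section g u v).
Proof. exact: section_funE. Qed.

Lemma section_uniq n (g : aut X) (u : level X n) (h : aut (shift n X))
    (u' : vertex X) :
  (forall v, g (vcat (val u) v) = vcat u' (h v)) -> vsize u' = n ->
  section g u = h.
Proof.
by move=> H Hu'; apply: autP => v /=; rewrite /section_fun H vdrop_vcat.
Qed.

Lemma vsize_level n (u : level X n) : vsize (val u) = n.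
Proof. exact/eqP/(valP u). Qed.

Lemma level_aut1 n (u : level X n) : level_aut 1 u = u.
Proof. exact: val_inj. Qed.

Lemma level_autM n (g h : aut X) (u : level X n) :
  level_aut (g * h) u = level_aut h (level_aut g u).
Proof. exact: val_inj. Qed.

Lemma section1 n (u : level X n) : section 1 u = 1.
Proof. by apply: (section_uniq (u' := val u)); rewrite ?vsize_level. Qed.

Lemma sectionM n (g h : aut X) (u : level X n) :
  section (g * h) u = section g u * section h (level_aut g u).
Proof.
apply: (section_uniq (u' := val (level_aut (g * h) u))) => [v|].
  by rewrite autME section_aut section_aut level_autM.
exact: vsize_level.
Qed.

Lemma sectionV n (g : aut X) (u : level X n) :
  section g^-1 u = (section g (level_aut g^-1 u))^-1.
Proof.
apply: (mulIg (section g (level_aut g^-1 u))).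
by rewrite -sectionM mulVg mulVg section1.
Qed.

Definition fixes n (g : aut X) := forall v, (vsize v <= n)%N -> g v = v.

Lemma fixesM n (g h : aut X) : fixes n g -> fixes n h -> fixes n (g * h).
Proof. by move=> Hg Hh v Hv; rewrite autME Hg ?Hh. Qed.

Lemma fixesV n (g : aut X) : fixes n g -> fixes n g^-1.
Proof. by move=> Hg v Hv; rewrite -{1}(Hg v Hv) autKV. Qed.

Lemma fixesX n (g : aut X) k : fixes n g -> fixes n (g ^+ k).
Proof. by move=> Hg; elim: k => // k IH; rewrite expgS; apply: fixesM. Qed.

Lemma fixesJ n (g h : aut X) : fixes n g -> fixes n (g ^ h).
Proof.
by move=> Hg v Hv; rewrite conjgE !autME Hg ?autVK // vsize_aut.
Qed.

Lemma fixes_comm n (g h : aut X) : fixes n g -> fixes n [~ g, h].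
Proof.
by move=> Hg; rewrite commgEl; apply: fixesM; [apply: fixesV | apply: fixesJ].
Qed.

Lemma fixes_level n (g : aut X) (u : level X n) : fixes n g -> level_aut g u = u.
Proof. by move=> Hg; apply: val_inj; apply: Hg; rewrite vsize_level. Qed.

Lemma fixes_level_iter n (g : aut X) k (u : level X n) :
  fixes n (g ^+ k) -> iter k (level_aut g) u = u.
Proof.
move=> H; rewrite -[RHS](fixes_level u H) {H}; elim: k => [|k IH]; first by rewrite expg0 level_aut1.
by rewrite expgSr level_autM -IH.
Qed.

Lemma fixes0 (g : aut X) : fixes 0 g.
Proof. by move=> v; case: v => [|y w] // _; rewrite aut_root. Qed.

Lemma section_comm n (g h : aut X) (u : level X n) : fixes n g ->
  section [~ g, h] u = (section g u)^-1 *
    section g (level_aut h^-1 u) ^ section h (level_aut h^-1 u).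
Proof.
move=> Hg; rewrite commgEl conjgE !sectionM sectionV sectionV.
by rewrite !(fixes_level _ (fixesV Hg)) !(fixes_level _ Hg) conjgE.
Qed.

Lemma section_fixesX n (g : aut X) k (u : level X n) : fixes n g ->
  section (g ^+ k) u = section g u ^+ k.
Proof.
move=> Hg; elim: k => [|k IH]; first by rewrite !expg0 section1.
by rewrite !expgS sectionM (fixes_level _ Hg) IH.
Qed.

Lemma fixes_section_eq1 n (g : aut X) :
  fixes n g -> (forall u : level X n, section g u = 1) -> g = 1.
Proof.
move=> Hg Hs; apply: autP => v; rewrite aut1E.
have [/Hg //|Hv] := leqP (vsize v) n.
have Hu : vsize (vtake n v) == n by rewrite vsize_vtake // ltnW.
rewrite -(vcat_take_drop (ltnW Hv)).
rewrite (section_aut g (exist _ (vtake n v) Hu)) Hs aut1E.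
by rewrite (fixes_level _ Hg).
Qed.

Lemma fixesS n (g : aut X) : fixes n g ->
  (forall (u : level X n) v, vsize v = 1%N -> section g u v = v) ->
  fixes n.+1 g.
Proof.
move=> Hg Hs v; rewrite leq_eqVlt => /predU1P[Hv|]; last by rewrite ltnS; apply: Hg.
have nv : (n <= vsize v)%N by rewrite Hv.
have Hu : vsize (vtake n v) == n by rewrite vsize_vtake.
rewrite -(vcat_take_drop nv).
rewrite (section_aut g (exist _ (vtake n v) Hu)) Hs ?(fixes_level _ Hg) //.
have := congr1 (@vsize _) (vcat_take_drop nv).
by rewrite vsize_vcat ?(eqP Hu) // Hv -addn1 => /addnI.
Qed.

End LevelSections.

(** * Copies of an automorphism below one vertex of the first level *)

Section Wreath.
Variable X : nat -> finType.

Fact at1_subK (y : X 0) (k : aut (shift 1 X)) : cancel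
  (fun v : vertex X => if v is Cons z w then Cons z (if z == y then k w else w)
   else Root)
  (fun v : vertex X => if v is Cons z w then Cons z (if z == y then k^-1 w else w)
   else Root).
Proof. by case=> // z w; case: eqP => // _; rewrite autKV. Qed.

Fact at1_child (y : X 0) (k : aut (shift 1 X)) (u v : vertex X) : child u v ->
  child (if u is Cons z w then Cons z (if z == y then k w else w) else Root)
    (if v is Cons z w then Cons z (if z == y then k w else w) else Root).
Proof.
move=> /childE[[-> [z ->]]|[z [u' [v' [-> -> uv]]]]].
  by rewrite aut_root if_same; apply: child_Root.
by apply: child_Cons; case: eqP => // _; apply: child_aut.
Qed.

Definition at1 (y : X 0) (k : aut (shift 1 X)) : aut X :=
  aut_of (@at1_subK y k)
    (fun v => ltac:(by have := @at1_subK y k^-1 v; rewrite invgK))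
    (erefl _) (@at1_child y k) (@at1_child y k^-1).

Lemma at1E y k z w :
  at1 y k (Cons z w) = Cons z (if z == y then k w else w).
Proof. by []. Qed.

Lemma sec1_at1 y k z : sec1 (at1 y k) z = if z == y then k else 1.
Proof. by apply: sec1_def (z) _ _ => v; rewrite at1E; case: eqP. Qed.

Lemma at1M y k l : at1 y (k * l) = at1 y k * at1 y l.
Proof.
apply: autP => -[//|z w]; rewrite autME !at1E.
by case: (z =P y).
Qed.

Lemma at11 y : at1 y 1 = 1.
Proof. by apply: autP => -[//|z w]; rewrite at1E if_same. Qed.

Lemma at1V y k : at1 y k^-1 = (at1 y k)^-1.
Proof. by apply: (mulIg (at1 y k)); rewrite -at1M !mulVg at11. Qed.

(** A nontrivial copy remembers its vertex, the only one of the first level with a nontrivial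
    section. *)
Lemma at1_inj y y' k k' : at1 y k = at1 y' k' -> k <> 1 -> y = y' /\ k = k'.
Proof.
move=> E k1; have := congr1 (fun g : aut X => sec1 g y) E.
rewrite !sec1_at1 eqxx; case: eqP => // _ kk; by rewrite kk in k1.
Qed.

End Wreath.

(* One level of the construction: [gn i] for [i < rk] are the generators e_i of
   the group, [ps i] for [i < npos] the positions x_i carrying the generators of
   the next level, and [nrm] a length in which multiples of generators have
   length at most 1. *)
Record datum := Datum {
  lab : finZmodType;
  rk : nat;
  gn : nat -> lab;
  npos : nat;
  ps : nat -> lab;
  nrm : lab -> nat
}.

Definition tree (D : nat -> datum) : nat -> finType := fun n => lab (D n).
Definition dshift (n : nat) (D : nat -> datum) : nat -> datum :=
  fun m => D (n + m)%N.

(** * Rooted and directed automorphisms *)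

Section Gens.
Variable D : nat -> datum.
Implicit Types (a y : lab (D 0)) (v : vertex (tree D)).

Definition rootf a v : vertex (tree D) :=
  if v is Cons y w then @Cons (tree D) (y + a)%R w else Root.

Fact rootfK a : cancel (rootf a) (rootf (- a)%R).
Proof. by case=> //= y w; rewrite addrK. Qed.

Fact rootfVK a : cancel (rootf (- a)%R) (rootf a).
Proof. by case=> //= y w; rewrite subrK. Qed.

Fact rootf_child a u v : child u v -> child (rootf a u) (rootf a v).
Proof.
move=> /childE[[-> [y ->]]|[y [u' [v' [-> -> uv]]]]]; first exact: child_Root.
exact: child_Cons.
Qed.

Definition rooted a : aut (tree D) :=
  aut_of (rootfK a) (rootfVK a) erefl (@rootf_child a) (@rootf_child (- a)%R).

Lemma rootedE a y w : rooted a (Cons y w) = @Cons (tree D) (y + a)%R w.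
Proof. by []. Qed.

Lemma rootedD a b : rooted (a + b)%R = rooted a * rooted b.
Proof. by apply: autP => -[//|y w]; rewrite autME !rootedE addrA. Qed.

Lemma rooted0 : rooted 0%R = 1.
Proof. by apply: autP => -[//|y w]; rewrite rootedE addr0. Qed.

Lemma rootedN a : rooted (- a)%R = (rooted a)^-1.
Proof. by apply: (mulIg (rooted a)); rewrite -rootedD addNr mulVg rooted0. Qed.

Lemma sec1_rooted a y : sec1 (rooted a) y = 1.
Proof. by apply: (@sec1_def _ _ _ (y + a)%R) => v; rewrite rootedE. Qed.

Definition pos y : option 'I_(npos (D 0)) := [pick i : 'I_(npos (D 0)) | ps (D 0) i == y].

End Gens.

(* [dirf k] is the action of b^k; an integer [k] makes the inverse explicit. *)
Fixpoint dirf (D : nat -> datum) (k : int) (v : vertex (tree D)) :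
    vertex (tree D) :=
  match v with
  | Root => Root
  | Cons y w => Cons y
      (if y == 0%R :> lab (D 0) then @dirf (dshift 1 D) k w
       else if pos y is Some i then @rootf (dshift 1 D) (gn (D 1) i *~ k)%R w
       else w)
  end.

(** The subtree below a first-level vertex is [tree (dshift 1 D)] by conversion; the induction
    principle of [vertex] would generalise [tree D] to an arbitrary sequence and lose the data
    [D]. *)
Lemma tree_ind (P : forall D, vertex (tree D) -> Prop) :
  (forall D, P D Root) ->
  (forall D y w, P (dshift 1 D) w -> P D (@Cons (tree D) y w)) ->
  forall D v, P D v.
Proof.
by move=> H0 HS; fix IH 2 => D; case=> [|y w]; [apply: H0 | apply/HS/IH].
Qed.

Lemma dirf_add D k l (v : vertex (tree D)) :
  dirf k (dirf l v) = dirf (l + k)%R v.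
Proof.
elim/tree_ind: D / v => // D y w IH /=.
case: eqP => [_|_]; first by rewrite IH.
case: pos => [i|] //; rewrite mulrzDr; congr Cons.
by case: w {IH} => //= z w; rewrite addrA.
Qed.

Lemma dirf0 D (v : vertex (tree D)) : dirf 0 v = v.
Proof.
elim/tree_ind: D / v => // D y w IH /=; rewrite IH.
case: eqP => // _; case: pos => // i; rewrite mulr0z.
by case: w {IH} => //= z w; rewrite addr0.
Qed.

Lemma dirfK D k : cancel (@dirf D k) (@dirf D (- k)).
Proof. by move=> v; rewrite dirf_add addrN dirf0. Qed.

Lemma dirfVK D k : cancel (@dirf D (- k)) (@dirf D k).
Proof. by move=> v; rewrite dirf_add addNr dirf0. Qed.

Lemma dirf_child D k (u v : vertex (tree D)) :
  child u v -> child (dirf k u) (dirf k v).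
Proof.
elim/tree_ind: D / u v => [D|D y w IH] v /childE.
  case=> [[_ [y ->]]|[y [? [? []]]]] //=.
  by case: eqP => _; last case: pos => [i|]; apply: child_Root.
case=> [[] //|[y' [u' [v' [[<- <-] -> uv]]]]].
apply: child_Cons; case: eqP => _; first exact: IH.
by case: pos => [i|] //; apply: rootf_child.
Qed.

Definition dir D k : aut (tree D) :=
  aut_of (@dirfK D k) (@dirfVK D k) erefl (@dirf_child D k)
    (@dirf_child D (- k)).

(* The section of b^k at the first-level vertex [y]. *)
Definition dlab D k (y : lab (D 0)) : aut (tree (dshift 1 D)) :=
  if y == 0%R then dir _ k
  else if pos y is Some i then @rooted (dshift 1 D) (gn (D 1) i *~ k)%R else 1.

Lemma dirE D k y w : dir D k (Cons y w) = @Cons (tree D) y (dlab k y w).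
Proof. by rewrite /dlab /=; congr Cons; case: eqP => // _; case: pos. Qed.

Lemma dirD D k l : dir D (k + l)%R = dir D k * dir D l.
Proof. by apply: autP => v; rewrite autME /= dirf_add. Qed.

Lemma dir0 D : dir D 0 = 1.
Proof. by apply: autP => v; apply: dirf0. Qed.

Lemma dirN D k : dir D (- k)%R = (dir D k)^-1.
Proof. by apply: (mulIg (dir D k)); rewrite -dirD addNr mulVg dir0. Qed.

Lemma sec1_dir D k y : sec1 (dir D k) y = dlab k y.
Proof. by apply: (@sec1_def _ _ _ y) => v; rewrite dirE. Qed.

(** * The generated group, word length and the action on the first level *)

Section Words.
Variable D : nat -> datum.

(* All powers of the generators count as letters, so that sections of letters
   are letters. *)
Inductive generator : aut (tree D) -> Prop :=
| GenRooted i k of (i < rk (D 0))%N : generator (rooted (gn (D 0) i *~ k)%R)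
| GenDir k : generator (dir D k).

Inductive ball : nat -> aut (tree D) -> Prop :=
| Ball1 : ball 0 1
| BallS s g l of generator s & ball l g : ball l.+1 (s * g).

Definition grp : set (aut (tree D)) := [set g | exists l, ball l g].

Lemma generator1 : generator 1.
Proof. by rewrite -(dir0 D); constructor. Qed.

Lemma generatorV s : generator s -> generator s^-1.
Proof. by case=> [i k ik|k]; rewrite -?rootedN -?mulrNz -?dirN; constructor. Qed.

Lemma ballW l m g : (l <= m)%N -> ball l g -> ball m g.
Proof.
move/subnK => <-; elim: (m - l)%N => // n IH /IH H.
by rewrite addSn -[g]mul1g; apply: BallS generator1 H.
Qed.

Lemma ballM l m g h : ball l g -> ball m h -> ball (l + m) (g * h).
Proof.
move=> + Hh; elim=> [|s k n Hs Hk IH]; first by rewrite mul1g.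
by rewrite -mulgA addSn; apply: BallS.
Qed.

Lemma ball_gen s : generator s -> ball 1 s.
Proof. by move=> Hs; rewrite -[s]mulg1; apply: BallS Hs Ball1. Qed.

Lemma ballV l g : ball l g -> ball l g^-1.
Proof.
elim=> [|s k n Hs Hk IH]; first by rewrite invg1; apply: Ball1.
by rewrite invgM -addn1; apply: ballM IH (ball_gen (generatorV Hs)).
Qed.

Lemma ballX l g n : ball l g -> ball (n * l) (g ^+ n).
Proof.
move=> Hg; elim: n => [|n IH]; first exact: Ball1.
by rewrite expgS mulSn; apply: ballM.
Qed.

Lemma ball_comm l m g h :
  ball l g -> ball m h -> ball (l.*2 + m.*2) [~ g, h].
Proof.
move=> Hg Hh; rewrite commgEl conjgE -!addnn.
have -> : (l + l + (m + m) = l + (m + (l + m)))%N by lia.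
by apply: ballM (ballV Hg) (ballM (ballV Hh) (ballM Hg Hh)).
Qed.

Lemma ball_iter_comm l g h n :
  ball l g -> ball l h -> ball (4 ^ n * l) (iter_comm g h n).
Proof.
move=> Hg Hh; elim: n => [|n IH] /=; first by rewrite mul1n.
apply: ballW (ball_comm IH Hh); rewrite expnS.
have : (0 < 4 ^ n)%N by rewrite expn_gt0.
move: (4 ^ n)%N => k k0; rewrite -!mul2n; nia.
Qed.

Lemma grp_subgroup : subgroup grp.
Proof.
split; first by exists 0%N; apply: Ball1.
- by move=> g h [l Hg] [m Hh]; exists (l + m)%N; apply: ballM.
- by move=> g [l Hg]; exists l; apply: ballV.
Qed.

Definition translates (c : lab (D 0)) (g : aut (tree D)) :=
  forall y w, g (Cons y w) = @Cons (tree D) (y + c)%R (sec1 g y w).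

Lemma translatesM c d g h :
  translates c g -> translates d h -> translates (c + d)%R (g * h).
Proof.
move=> Hg Hh y w; have [z [E1 E2]] := sec1E (g * h) y w.
rewrite E1; congr Cons.
by move: E2; rewrite autME Hg Hh addrA => -[].
Qed.

Lemma translates_generator s : generator s -> exists c, translates c s.
Proof.
case=> [i k _|k]; [eexists => y w; by rewrite rootedE sec1_rooted | exists 0%R => y w].
by rewrite dirE sec1_dir addr0.
Qed.

Lemma translates_grp g : grp g -> exists c, translates c g.
Proof.
case=> l; elim=> [|s h n /translates_generator[c Hc] _ [d Hd]].
  by exists 0%R => y w; rewrite addr0 (@sec1_def _ _ _ y 1).
by exists (c + d)%R; apply: translatesM.
Qed.

(* The label by which [g] translates the first level; junk if [g] does not act
   there as a translation. *)
Definition shiftlab (g : aut (tree D)) : lab (D 0) :=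
  if g (@Cons (tree D) 0%R Root) is Cons z _ then z else 0%R.

Lemma translates_shiftlab c g : translates c g -> shiftlab g = c.
Proof. by move=> H; rewrite /shiftlab H add0r. Qed.

Lemma shiftlabP g : grp g -> translates (shiftlab g) g.
Proof. by move=> /translates_grp[c Hc]; rewrite (translates_shiftlab Hc). Qed.

Lemma shiftlabM g h : grp g -> grp h ->
  shiftlab (g * h) = (shiftlab g + shiftlab h)%R.
Proof.
move=> Hg Hh; apply: translates_shiftlab.
exact: translatesM (shiftlabP Hg) (shiftlabP Hh).
Qed.

Lemma shiftlab1 : shiftlab 1 = 0%R. Proof. by []. Qed.

Lemma shiftlabV g : grp g -> shiftlab g^-1 = (- shiftlab g)%R.
Proof.
move=> Hg; have [_ _ HV] := grp_subgroup.
by apply: (addrI (shiftlab g)); rewrite -shiftlabM ?mulgV ?addrN //; apply: HV.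
Qed.

Lemma sec1M (g h : aut (tree D)) y : grp g ->
  sec1 (g * h) y = sec1 g y * sec1 h (y + shiftlab g)%R.
Proof.
move=> Hg; apply: (sec1_def (z := if h (Cons (y + shiftlab g)%R Root) is Cons z _ then z else y)) => v.
rewrite autME (shiftlabP Hg) autME.
by have [z [-> ->]] := sec1E h (y + shiftlab g)%R (sec1 g y v).
Qed.

Lemma sec11 (X : nat -> finType) y : sec1 (1 : aut X) y = 1.
Proof. exact: (@sec1_def _ _ _ y). Qed.

End Words.

Lemma grpM D (g h : aut (tree D)) : grp g -> grp h -> grp (g * h).
Proof. by have [_ H _] := grp_subgroup D; apply: H. Qed.

Lemma grpV D (g : aut (tree D)) : grp g -> grp g^-1.
Proof. by have [_ _ H] := grp_subgroup D; apply: H. Qed.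

Lemma grp1 D : grp (1 : aut (tree D)).
Proof. by have [] := grp_subgroup D. Qed.

Lemma grpX D (g : aut (tree D)) n : grp g -> grp (g ^+ n).
Proof. by case=> l /ballX H; exists (n * l)%N. Qed.

Lemma grp_comm D (g h : aut (tree D)) : grp g -> grp h -> grp [~ g, h].
Proof.
by move=> Hg Hh; rewrite commgEl conjgE; do ?apply: grpM; do ?apply: grpV.
Qed.

(** From [j * 'C(p ^ r, j) = p ^ r * 'C((p ^ r).-1, j.-1)]: were the binomial coefficient prime to
    [p], then [p ^ r] would divide [j]. *)
Lemma prime_dvd_bin_exp p r j : prime p -> (0 < j < p ^ r)%N ->
  (p %| 'C(p ^ r, j))%N.
Proof.
move=> pp /andP[j0 jr]; apply: contraLR (jr); rewrite -leqNgt => ncop.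
apply: dvdn_leq => //.
have cop : coprime (p ^ r) 'C(p ^ r, j) by rewrite coprimeXl // prime_coprime.
rewrite -(Gauss_dvdr _ cop) mulnC.
by case: j j0 {jr ncop cop} => // j _; rewrite -mul_bin_diag dvdn_mulr.
Qed.

(** * Periodic sequences under iterated differences *)

Section FiniteDifferences.
Variable C : zmodType.
Implicit Types (f : nat -> C).
Local Open Scope ring_scope.

Definition fdiff f i := f i.+1 - f i.

Lemma fdiff_binomial n f i : iter n fdiff f i =
  \sum_(j < n.+1) (f (i + j)%N *~ ((-1) ^+ (n + j) * 'C(n, j)%:Z)).
Proof.
pose c n j : int := (-1) ^+ (n + j) * 'C(n, j)%:Z.
elim: n i => [|n IH] i.
  by rewrite big_ord_recl big_ord0 addr0 addn0 bin0 mulr1 mulr1z.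
have c0 : c n.+1 0%N = - c n 0%N by rewrite /c !bin0 !addn0 exprS mulN1r mulNr.
have cS j : c n.+1 j.+1 = c n j - c n j.+1.
  by rewrite /c binS PoszD addSn addnS !exprS !mulN1r opprK mulrDr addrC mulNr opprK.
have cn : c n n.+1 = 0 by rewrite /c bin_small ?mulr0.
rewrite iterS /fdiff !IH [RHS]big_ord_recl -/(c _ _) c0 addn0 mulrNz.
under [X in _ = _ + X]eq_bigr => j _.
  rewrite lift0 -/(c _ _) cS mulrzBr addnS -addSn; over.
rewrite sumrB addrCA; congr (_ + _); rewrite -opprD; congr (- _).
transitivity (\sum_(j < n.+2) f (i + j)%N *~ c n j).
  by rewrite [RHS]big_ord_recr /= cn mulr0z addr0.
rewrite big_ord_recl addn0; congr (_ + _); apply: eq_bigr => j _.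
by rewrite lift0 addnS addSn.
Qed.

(* With T the shift of sequences, (T - 1)^(p^r) = T^(p^r) - 1 modulo p. *)
Lemma fdiff_exp p r f : prime p -> (forall i, f (i + p ^ r)%N = f i) ->
  exists2 Y, forall i, iter (p ^ r) fdiff f i = Y i *+ p &
             forall i, Y (i + p ^ r)%N = Y i.
Proof.
move=> pp per; set P := (p ^ r)%N.
have P0 : (0 < P)%N by rewrite expn_gt0 prime_gt0.
pose c j : int := (-1) ^+ (P + j) * ('C(P, j) %/ p)%N%:Z.
pose Y0 i := \sum_(j < P.-1) f (i + j.+1)%N *~ c j.+1.
have Y0P i : Y0 (i + P)%N = Y0 i.
  by apply: eq_bigr => j _; rewrite addnAC per.
have D i : iter P fdiff f i = f i *~ (-1) ^+ P + f i + Y0 i *+ p.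
  rewrite fdiff_binomial big_ord_recr /= per binn mulr1 -signr_odd oddD addbb mulr1z.
  have split0 m (F : nat -> C) : (0 < m)%N ->
      \sum_(j < m) F j = F 0%N + \sum_(j < m.-1) F j.+1.
    by case: m => // m _; rewrite big_ord_recl.
  rewrite (split0 P (fun j => f (i + j)%N *~ ((-1) ^+ (P + j) * 'C(P, j)%:Z))) //.
  rewrite !addn0 bin0 mulr1 addrAC; congr (_ + _).
  rewrite -sumrMnl; apply: eq_bigr => j _.
  rewrite /c pmulrn -mulrzA -mulrA -PoszM divnK //.
  apply: prime_dvd_bin_exp => //=; have := ltn_ord j; rewrite -/P; lia.
(* For odd [p] the two end terms of the expansion cancel. For [p = 2] and [r > 0] they add up to
   twice [f i], again a multiple of [p]; for [r = 0] the sequence is constant. *)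
have [p2|odd_p] := even_prime pp; last first.
  exists Y0 => // i; rewrite D -signr_odd oddX odd_p orbT expr1 mulrN1z addNr.
  by rewrite add0r.
have [r0|r0] := posnP r.
  exists (fun=> 0) => // i; rewrite mul0rn /P r0 /= /fdiff.
  by rewrite -[i.+1]addn1 -[1%N](expn0 p) -r0 per subrr.
exists (fun i => f i + Y0 i) => i; last by rewrite per Y0P.
have oddP : odd P = false by rewrite /P oddX p2 orbF eqn0Ngt r0.
by rewrite D -signr_odd oddP expr0 mulr1z mulrnDl {2}p2 mulr2n.
Qed.

(** Each block of [p ^ r] differences yields one factor [p], and the quotient sequence keeps the
    period. *)
Lemma fdiff_exp_iter p r t f : prime p -> (forall i, f (i + p ^ r)%N = f i) ->
  exists Y, forall i, iter (t * p ^ r) fdiff f i = Y i *+ (p ^ t).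
Proof.
move=> pp; elim: t f => [|t IH] f per.
  by exists f => i; rewrite mul0n mulr1n.
have [Y HY perY] := fdiff_exp pp per.
have [Z HZ] := IH _ perY; exists Z => i.
have fdiffMn n g j : iter n fdiff (fun l => g l *+ p) j = iter n fdiff g j *+ p.
  by elim: n j => // n IHn j; rewrite /= /fdiff !IHn mulrnBl.
rewrite mulSn addnC iterD expnSr mulrnA -HZ -fdiffMn.
by congr (iter _ _ _ _); apply: funext.
Qed.

End FiniteDifferences.

(** * Contraction of words *)

(** [E] is a common exponent of all levels, so that bounds on orders depend on the depth only.
    [ps_sum0] and [ps_sum] are the sum-freeness behind branching, [gn_ind] says that the [gn i]
    generate, and the last four fields make [nrm] a length that word length dominates. *)
Record admissible (E : nat) (D : nat -> datum) : Prop := Admissible {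
  npos_rk : forall n, npos (D n) = rk (D n.+1);
  ps_inj : forall n i j, (i < npos (D n))%N -> (j < npos (D n))%N ->
    ps (D n) i = ps (D n) j -> i = j;
  ps_sum0 : forall n i j, (i < npos (D n))%N -> (j < npos (D n))%N ->
    (ps (D n) i + ps (D n) j)%R <> 0%R;
  ps_sum : forall n i j k, (i < npos (D n))%N -> (j < npos (D n))%N ->
    (k < npos (D n))%N -> (ps (D n) i + ps (D n) j)%R <> ps (D n) k;
  gn_ind : forall n (P : lab (D n) -> Prop), P 0%R ->
    (forall i k a, (i < rk (D n))%N -> P a -> P (gn (D n) i *~ k + a)%R) ->
    forall a, P a;
  gn_neq0 : forall n, exists2 i, (i < rk (D n))%N & gn (D n) i <> 0%R;
  lab_exp : forall n (a : lab (D n)), (a *+ E = 0)%R;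
  nrm0 : forall n, nrm (0%R : lab (D n)) = 0%N;
  nrmD : forall n (a b : lab (D n)), (nrm (a + b)%R <= nrm a + nrm b)%N;
  nrmN : forall n (a : lab (D n)), nrm (- a)%R = nrm a;
  nrm_gn : forall n i k, (i < rk (D n))%N -> (nrm (gn (D n) i *~ k)%R <= 1)%N
}.

Lemma admissible_shift E D n : admissible E D -> admissible E (dshift n D).
Proof.
move=> gD; split=> m.
- by rewrite /dshift addnS; apply: npos_rk gD _.
- exact: ps_inj gD _.
- exact: ps_sum0 gD _.
- exact: ps_sum gD _.
- exact: gn_ind gD _.
- exact: gn_neq0 gD _.
- exact: lab_exp gD _.
- exact: nrm0 gD _.
- exact: nrmD gD _.
- exact: nrmN gD _.
- exact: nrm_gn gD _.
Qed.

Definition center (D : nat -> datum) (y : lab (D 0)) : Prop :=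
  y = 0%R \/ exists2 i, (i < npos (D 0))%N & y = ps (D 0) i.

(** The factor 2 comes from the triangle inequality: a ball of radius [M] about any label then
    contains at most one center. *)
Definition separated (D : nat -> datum) (M : nat) : Prop :=
  forall y z : lab (D 0), center y -> center z -> (nrm (y - z)%R <= M.*2)%N ->
  y = z.

Section Contraction.
Variable E : nat.

Lemma pos_Some D (y : lab (D 0)) i : pos y = Some i -> y = ps (D 0) i.
Proof. by rewrite /pos; case: pickP => // j /eqP <- [<-]. Qed.

Lemma pos_None D (y : lab (D 0)) i :
  pos y = None -> (i < npos (D 0))%N -> y <> ps (D 0) i.
Proof.
rewrite /pos; case: pickP => // H _ Hi Ey.
by have := H (Ordinal Hi); rewrite /= Ey eqxx.
Qed.

Lemma pos_ps D i : admissible E D -> (i < npos (D 0))%N ->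
  exists2 j, pos (ps (D 0) i) = Some j & val j = i.
Proof.
move=> gD Hi; case Ep : (pos (ps (D 0) i)) => [j|]; last by case: (pos_None Ep Hi).
by exists j => //; apply: (ps_inj gD) (esym (pos_Some Ep)).
Qed.

Lemma dlab_notcenter D k (y : lab (D 0)) : ~ center y -> dlab k y = 1.
Proof.
move=> Hy; rewrite /dlab; case: eqP => [Ey|_]; first by case: Hy; left.
by case Ep: pos => [i|//]; case: Hy; right; exists i => //; apply: pos_Some.
Qed.

Lemma dlabD D k l (y : lab (D 0)) : dlab (k + l)%R y = dlab k y * dlab l y.
Proof.
rewrite /dlab; case: eqP => _; first exact: dirD.
by case: pos => [i|]; rewrite ?mulg1 // mulrzDr rootedD.
Qed.

Lemma dlab0 D (y : lab (D 0)) : dlab 0 y = 1.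
Proof.
rewrite /dlab; case: eqP => _; first exact: dir0.
by case: pos => [i|//]; rewrite mulr0z rooted0.
Qed.

Lemma dir_exp D k : admissible E D -> dir D (k *+ E)%R = 1.
Proof.
move=> gD; apply: autP => v; rewrite aut1E.
elim/tree_ind: D / v gD => // D y w IH gD; rewrite dirE /dlab; congr Cons.
case: eqP => _; first exact/IH/admissible_shift.
case: pos => [i|//].
by rewrite pmulrn mulrzz mulrzA -pmulrn (lab_exp gD) rooted0.
Qed.

Lemma dlab_exp D k (y : lab (D 0)) : admissible E D -> dlab (k *+ E)%R y = 1.
Proof.
move=> gD; rewrite /dlab; case: eqP => _; first exact/dir_exp/admissible_shift.
by case: pos => [i|//]; rewrite pmulrn mulrzz mulrzA -pmulrn (lab_exp gD) rooted0.
Qed.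

Lemma generator_sec1 D s (y : lab (D 0)) : admissible E D -> generator s ->
  @generator (dshift 1 D) (sec1 s y).
Proof.
move=> gD; case=> [i k _|k]; first by rewrite sec1_rooted; apply: generator1.
rewrite sec1_dir /dlab; case: eqP => _; first exact: GenDir.
case: pos => [i|]; last exact: generator1.
by apply: (@GenRooted (dshift 1 D)); rewrite /dshift /= -(npos_rk gD).
Qed.

Lemma generator_grp D (s : aut (tree D)) : generator s -> grp s.
Proof. by move/ball_gen; exists 1%N. Qed.

Lemma ball_sec1 D l g (y : lab (D 0)) : admissible E D -> ball l g ->
  @ball (dshift 1 D) l (sec1 g y).
Proof.
move=> gD Hg; elim: Hg y => [|s h n Hs Hh IH] y.
  by rewrite sec11; apply: Ball1.
rewrite sec1M; last exact: generator_grp.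
exact: BallS (generator_sec1 _ gD Hs) (IH _).
Qed.

Lemma ball_section D n l g (u : level (tree D) n) : admissible E D -> ball l g ->
  @ball (dshift n D) l (section g u).
Proof.
elim: n D g u => [|n IH] D g u gD Hg; first by rewrite section0.
have [y [v ->]] := lconsP u; rewrite section_lcons.
by apply: (IH (dshift 1 D)); [apply: admissible_shift | apply: ball_sec1].
Qed.

Lemma grp_section D n g (u : level (tree D) n) : admissible E D -> grp g ->
  @grp (dshift n D) (section g u).
Proof. by move=> gD [l Hg]; exists l; apply: ball_section. Qed.

Lemma level_aut_lcons D n g y (u : level (shift 1 (tree D)) n) : grp g ->
  level_aut g (lcons y u) =
  @lcons (tree D) n (y + shiftlab g)%R (level_aut (sec1 g y) u).
Proof. by move=> Hg; apply: val_inj; rewrite /= (shiftlabP Hg). Qed.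

Lemma nrm_shiftlab D l g : admissible E D -> ball l g -> (nrm (@shiftlab D g) <= l)%N.
Proof.
move=> gD; elim=> [|s h n Hs Hh IH]; first by rewrite shiftlab1 (nrm0 gD).
have sG := generator_grp Hs; have hG : grp h by exists n.
rewrite shiftlabM //; apply: leq_trans (nrmD gD _ _) _; rewrite -add1n.
apply: leq_add IH; case: Hs {sG} => [i k ik|k].
  by rewrite (@translates_shiftlab _ (gn (D 0) i *~ k)%R) ?(nrm_gn gD) // => y w;
    rewrite rootedE sec1_rooted.
by rewrite (@translates_shiftlab _ 0%R) ?(nrm0 gD) // => y w;
    rewrite dirE sec1_dir addr0.
Qed.

(** The section of a word is the product of the sections of its letters at the labels met on the
    way. These labels stay within [M] of [x], where only one center [c] can occur, so every factor
    is trivial or a power of the letter at [c]. *)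
Lemma sec1_local D M (x : lab (D 0)) : admissible E D -> separated D M ->
  exists c : lab (D 0), forall R w y, ball R w -> (nrm (y - x)%R + R <= M)%N ->
  exists k, sec1 w y = dlab k c.
Proof.
move=> gD sep.
have [c Hc] : exists c : lab (D 0), forall y, center y -> (nrm (y - x)%R <= M)%N -> y = c.
  have [[c Hc nc]|no] := pselect (exists2 c, center c & (nrm (c - x)%R <= M)%N).
    exists c => y Hy ny; apply: sep => //.
    have -> : (y - c = (y - x) + - (c - x))%R by rewrite opprB addrA subrK.
    by apply: leq_trans (nrmD gD _ _) _; rewrite (nrmN gD) -addnn leq_add.
  (* With no center near [x] the sections are trivial, and any [c] will do. *)
  by exists 0%R => y Hy ny; case: no; exists y.
exists c => R w y Hw; elim: Hw y => [|s h n Hs Hh IH] y Hy.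
  by exists 0%R; rewrite sec11 dlab0.
have sG := generator_grp Hs.
rewrite sec1M //.
have [|l ->] := IH (y + shiftlab s)%R.
  apply: leq_trans Hy; rewrite addrAC.
  apply: leq_trans (leq_add (nrmD gD _ _) (leqnn n)) _.
  by rewrite -addnA leq_add2l -add1n leq_add2r (nrm_shiftlab gD (ball_gen Hs)).
case: Hs {sG} => [i k _|k]; first by exists l; rewrite sec1_rooted mul1g.
rewrite sec1_dir; have [Hcy|/dlab_notcenter->] := pselect (center y).
  exists (k + l)%R; rewrite dlabD; congr (dlab _ _ * _); apply: Hc => //.
  by apply: leq_trans Hy; rewrite leq_addr.
by exists l; rewrite mul1g.
Qed.

(* The words of length at most [M] have all their sections near [v] in the
   powers of a single letter, because at most one position is near [v]. *)
Lemma section_local D n M (v : level (tree D) n.+1) :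
  admissible E D -> separated (dshift n D) M ->
  exists z : int -> aut (shift n.+1 (tree D)),
  [/\ forall k l, z (k + l)%R = z k * z l,
      forall k, z (k *+ E)%R = 1 &
      forall d R h w, ball d h -> ball R w -> (d + R <= M)%N ->
      exists k, section w (level_aut h v) = z k].
Proof.
elim: n D v => [|n IH] D v gD sep.
  have [y [u ->]] := lconsP v; have [c Hc] := sec1_local y gD sep.
  exists (fun k => dlab k c); split=> [k l|k|d R h w Hh Hw le].
  - exact: dlabD.
  - exact: dlab_exp.
  have hG : grp h by exists d.
  have [|k Hk] := Hc R w (y + shiftlab h)%R Hw.
    by rewrite addrAC subrr add0r (leq_trans _ le) // leq_add2r (nrm_shiftlab gD).
  by exists k; rewrite level_aut_lcons // section_lcons section0.
have [y [u ->]] := lconsP v.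
have [z [zD zE Hz]] := IH (dshift 1 D) u (admissible_shift 1 gD) sep.
exists z; split=> // d R h w Hh Hw le.
have hG : grp h by exists d.
rewrite level_aut_lcons // section_lcons.
by apply: (Hz d R) => //; apply: ball_sec1.
Qed.
End Contraction.

Lemma iter_commD (gT : groupType) (g h : gT) m n :
  iter_comm g h (m + n) = iter_comm (iter_comm g h m) h n.
Proof. by elim: n => [|n IH]; rewrite ?addn0 // addnS /= IH. Qed.

(** * Engel and torsion properties of words *)

Section EngelTorsion.
Variables (p T : nat).
Hypothesis pp : prime p.
Local Notation E := (p ^ T)%N.

Lemma fixes_size1 D (g : aut (tree D)) v :
  grp g -> shiftlab g = 0%R -> vsize v = 1%N -> g v = v.
Proof.
move=> Hg g0; case: v => // y [] // _.
by rewrite (shiftlabP Hg) g0 addr0 aut_root.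
Qed.

Lemma shiftlabX D (g : aut (tree D)) n : grp g ->
  shiftlab (g ^+ n) = (shiftlab g *+ n)%R.
Proof.
move=> Hg; elim: n => [|n IH]; first by rewrite expg0.
by rewrite expgS shiftlabM ?IH ?mulrS //; apply: grpX.
Qed.

(** A section of a group element moves the first level by a translation, of order dividing [E]; so
    each further level costs one more factor [E] in the exponent. *)
Lemma fixes_expg D (h : aut (tree D)) n :
  admissible E D -> grp h -> fixes n (h ^+ (E ^ n)).
Proof.
move=> gD Hh; elim: n => [|n IH]; first exact: fixes0.
rewrite expnSr expgnA; apply: fixesS => [|u v Hv]; first exact: fixesX.
rewrite section_fixesX //.
have Hs := grp_section u gD (grpX (E ^ n) Hh).
apply: (@fixes_size1 (dshift n D)) Hv; first exact: grpX.
by rewrite (@shiftlabX (dshift n D)) // (lab_exp gD).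
Qed.

Lemma fixes_iter_comm (X : nat -> finType) (g h : aut X) k n :
  fixes n g -> fixes n (iter_comm g h k).
Proof. by move=> Hg; elim: k => // k IH; apply: fixes_comm. Qed.

Lemma grp_iter_comm D (g h : aut (tree D)) n : grp g -> grp h ->
  grp (iter_comm g h n).
Proof. by move=> Hg Hh; elim: n => // n IH; apply: grp_comm. Qed.

(** Labels are insensitive to conjugation, so along the [h^-1]-orbit of [u] commutation with [h]
    acts on the labels of the sections of [g] as the difference operator. [E ^ n] is a period of the
    orbit, and [T * E ^ n] differences leave a multiple of [E], which is zero. *)
Lemma iter_comm_fixesS D (g h : aut (tree D)) n : admissible E D ->
  grp g -> grp h -> fixes n g -> fixes n.+1 (iter_comm g h (T * E ^ n)).
Proof.
move=> gD Hg Hh Fg.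
pose L (k : aut (tree D)) (u : level (tree D) n) : lab (dshift n D 0) :=
  @shiftlab (dshift n D) (section k u).
apply: fixesS => [|u v Hv]; first exact: fixes_iter_comm.
apply: (@fixes_size1 (dshift n D)) Hv.
  by apply: (grp_section _ gD); apply: grp_iter_comm.
rewrite -/(L _ u).
pose f i := L g (iter i (level_aut h^-1) u).
have Lk k i : L (iter_comm g h k) (iter i (level_aut h^-1) u) = iter k (@fdiff _) f i.
  elim: k i => // k IH i; rewrite iterS /fdiff -!IH {1}/L /= section_comm; last first.
    exact: fixes_iter_comm.
  set a := section _ _; set b := section _ _; set c := section _ _.
  have Ga : @grp (dshift n D) a by apply: (grp_section _ gD); apply: grp_iter_comm.
  have Gb : @grp (dshift n D) b by apply: (grp_section _ gD); apply: grp_iter_comm.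
  have Gc : @grp (dshift n D) c by apply: (grp_section _ gD).
  rewrite conjgE !(@shiftlabM (dshift n D)) ?(@shiftlabV (dshift n D)) //;
    do ?[exact: grpV | exact: grpM | apply: grpM => //; exact: grpV | apply: grpM].
  by rewrite addrC [X in (X - _)%R]addrC addrK.
rewrite (Lk _ 0%N).
have per i : f (i + p ^ (T * n))%N = f i.
  rewrite /f iterD; congr (L g (iter _ _ _)).
  by rewrite expnM; apply/fixes_level_iter/fixes_expg => //; apply: grpV.
have [Y HY] := fdiff_exp_iter T pp per.
by rewrite -expnM HY (lab_exp gD).
Qed.

(** This count involves neither the word length nor the ranks of the levels, so the separation can
    be chosen afterwards to beat it. *)
Fixpoint depth_comm n : nat :=
  if n is n'.+1 then (depth_comm n' + T * E ^ n')%N else 0%N.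

Lemma iter_comm_fixes D (g h : aut (tree D)) n : admissible E D ->
  grp g -> grp h -> fixes n (iter_comm g h (depth_comm n)).
Proof.
move=> gD Hg Hh; elim: n => [|n IH] /=; first exact: fixes0.
by rewrite iter_commD; apply: iter_comm_fixesS => //; apply: grp_iter_comm.
Qed.

(** Once [[g,_k h]] fixes level n+1 its length is still at most [4 ^ k * l], so along an orbit of
    [h] its sections and those of [h] are powers of one letter. They commute, further commutators
    take differences of exponents, and enough differences make the exponent a multiple of [E]. *)
Lemma Engel_ball D n l M (g h : aut (tree D)) : admissible E D ->
  ball l g -> ball l h -> separated (dshift n D) M ->
  (E ^ n.+1 * l + 4 ^ depth_comm n.+1 * l <= M)%N ->
  iter_comm g h (depth_comm n.+1 + T * E ^ n.+1) = 1.
Proof.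
move=> gD Bg Bh sep leM; rewrite iter_commD.
have Hg : grp g by exists l.
have Hh : grp h by exists l.
have := iter_comm_fixes (n := n.+1) gD Hg Hh.
have := ball_iter_comm (depth_comm n.+1) Bg Bh.
have := grp_iter_comm (depth_comm n.+1) Hg Hh.
move: leM; set k0 := depth_comm _; move: (iter_comm g h k0) => {}g leM {}Hg {}Bg Fg.
apply: (fixes_section_eq1 (n := n.+1)) => [|v]; first exact: fixes_iter_comm.
have [z [zD zE Hz]] := section_local v gD sep.
pose vi i : level (tree D) n.+1 := iter i (level_aut h^-1) v.
have Fh : fixes n.+1 (h^-1 ^+ (E ^ n.+1)) by apply: fixes_expg => //; apply: grpV.
(* Reducing the exponent modulo [E ^ n.+1] bounds the length of the element that reaches [vi i],
   independently of [i]. *)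
have viE i : vi i = level_aut (h^-1 ^+ (i %% E ^ n.+1)) v.
  rewrite /vi {1}(divn_eq i (E ^ n.+1)) addnC iterD.
  have -> : iter (i %/ E ^ n.+1 * E ^ n.+1) (level_aut h^-1) v = v.
    by apply: fixes_level_iter; rewrite mulnC expgnA; apply: fixesX.
  elim: (i %% _)%N => [|j IH]; first by rewrite expg0 level_aut1.
  by rewrite expgSr level_autM -IH.
have E0 : (0 < E ^ n.+1)%N by rewrite !expn_gt0 prime_gt0.
have loc w R i : ball R w -> (R <= 4 ^ k0 * l)%N -> exists k, section w (vi i) = z k.
  move=> Bw leR; rewrite viE; apply: (Hz _ _ _ _ (ballX _ (ballV Bh)) Bw).
  apply: leq_trans leM; rewrite leq_add // leq_mul2r; apply/orP; right.
  exact/ltnW/ltn_pmod.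
have lh : (l <= 4 ^ k0 * l)%N by rewrite leq_pmull // expn_gt0.
(* The exponent is chosen as a function of the section and not of the index [i], so that the
   sequence [f] inherits the period of the orbit. On sections that are not powers of the letter its
   value is junk. *)
have chooseK (w : aut (shift n.+1 (tree D))) :
    exists m, (exists k, w = z k) -> w = z m.
  have [[k Hk]|no] := pselect (exists k, w = z k); first by exists k.
  by exists 0%R => /no.
have [K HK] := choice chooseK.
pose f i := K (section g (vi i)).
have Sk k i : section (iter_comm g h k) (vi i) = z (iter k (@fdiff _) f i).
  elim: k i => [|k IH] i; first by apply/HK/(loc _ _ _ Bg).
  rewrite iterS /fdiff /= section_comm; last exact: fixes_iter_comm.
  change (level_aut h^-1 (vi i)) with (vi i.+1); rewrite !IH.
  (* The section of [h] is a power of the same letter, so conjugation by it disappears. *)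
  have [m ->] := loc h l i.+1 Bh lh.
  have zC a b : z a * z b = z b * z a by rewrite -!zD addrC.
  rewrite conjgE zC mulKg; apply: (mulgI (z (iter k (@fdiff _) f i))).
  by rewrite mulVKg -zD addrC subrK.
have per i : f (i + p ^ (T * n.+1))%N = f i.
  rewrite /f /vi iterD; congr (K (section g (iter _ _ _))).
  by rewrite expnM; apply/fixes_level_iter.
have [Y HY] := fdiff_exp_iter T pp per.
by rewrite (Sk _ 0%N) -expnM HY zE.
Qed.

(** [h ^+ (E ^ n.+1)] fixes level n+1 and is short enough for its sections there to be powers of one
    letter, which a further exponent [E] kills. *)
Lemma torsion_ball D n l M (h : aut (tree D)) : admissible E D ->
  ball l h -> separated (dshift n D) M -> (E ^ n.+1 * l <= M)%N ->
  h ^+ (E ^ n.+2) = 1.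
Proof.
move=> gD Bh sep leM; have Hh : grp h by exists l.
have Fh := fixes_expg (n := n.+1) gD Hh.
rewrite expnSr expgnA.
apply: (fixes_section_eq1 (n := n.+1)) => [|v]; first exact: fixesX.
have [z [zD zE Hz]] := section_local v gD sep.
rewrite section_fixesX // -[v]level_aut1.
have [k ->] := Hz _ _ _ _ (Ball1 D) (ballX (E ^ n.+1) Bh) leM.
rewrite -(zE k); elim: (p ^ T)%N => [|m IH]; last by rewrite expgS mulrS zD IH.
by apply: (mulgI (z 0%R)); rewrite expg0 mulr0n -zD addr0 mulg1.
Qed.

End EngelTorsion.


(** * Branching over the derived subgroup *)

Definition der D : set (aut (tree D)) := comm_subgroup (@grp D) (@grp D).

Section Branching.
Variable E : nat.

Lemma der_comm D (g h : aut (tree D)) : grp g -> grp h -> der [~ g, h].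
Proof. by move=> Hg Hh; apply: generated_sub; exists g, h. Qed.

Lemma der_min D (H : set (aut (tree D))) : subgroup H ->
  (forall g h, grp g -> grp h -> H [~ g, h]) -> der (D := D) `<=` H.
Proof.
by move=> HH Hc; apply: generated_min => // _ [g [h [Hg Hh ->]]]; apply: Hc.
Qed.

Lemma der_subgroup D : subgroup (@der D).
Proof. exact: generated_subgroup. Qed.

Lemma der1 D : der (1 : aut (tree D)).
Proof. by have [] := der_subgroup D. Qed.

Lemma derM D (g h : aut (tree D)) : der g -> der h -> der (g * h).
Proof. by have [_ H _] := der_subgroup D; apply: H. Qed.

Lemma derV D (g : aut (tree D)) : der g -> der g^-1.
Proof. by have [_ _ H] := der_subgroup D; apply: H. Qed.

Lemma der_grp D : @der D `<=` @grp D.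
Proof. by apply: der_min; [apply: grp_subgroup | apply: grp_comm]. Qed.

Lemma grpJ D (g h : aut (tree D)) : grp g -> grp h -> grp (g ^ h).
Proof. by move=> Hg Hh; rewrite conjgE; apply/grpM/grpM => //; apply: grpV. Qed.

Lemma derJ D (k g : aut (tree D)) : grp g -> der k -> der (k ^ g).
Proof.
move=> Hg; apply: (der_min (H := [set x | der (x ^ g)])).
  exact/subgroup_conj/der_subgroup.
by move=> a b Ha Hb /=; rewrite conjRg; apply: der_comm; apply: grpJ.
Qed.

Lemma rooted_grp D a : admissible E D -> grp (@rooted D a).
Proof.
move=> gD; elim/(gn_ind gD): a => [|i k a Hi IH]; first by rewrite rooted0; apply: grp1.
by rewrite rootedD; apply: grpM => //; apply/generator_grp/GenRooted.
Qed.

Lemma dir_grp D k : grp (dir D k).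
Proof. exact/generator_grp/GenDir. Qed.

Lemma translates_ext D c (g h : aut (tree D)) : translates c g ->
  translates c h -> (forall y, sec1 g y = sec1 h y) -> g = h.
Proof.
move=> Hg Hh H; apply: autP => -[|y w]; first by rewrite !aut_root.
by rewrite Hg Hh H.
Qed.

Lemma translates_rooted D a : translates a (@rooted D a).
Proof. by move=> y w; rewrite sec1_rooted rootedE. Qed.

Lemma translates_dir D k : translates 0%R (dir D k).
Proof. by move=> y w; rewrite sec1_dir dirE addr0. Qed.

Lemma translates_at1 D y k : translates 0%R (@at1 (tree D) y k).
Proof. by move=> z w; rewrite sec1_at1 at1E addr0; case: eqP. Qed.

Lemma shiftlab_rooted D a : shiftlab (@rooted D a) = a.
Proof. exact/translates_shiftlab/translates_rooted. Qed.

Lemma shiftlab_dir D k : shiftlab (dir D k) = 0%R.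
Proof. exact/translates_shiftlab/translates_dir. Qed.

Lemma sec1V D (g : aut (tree D)) y : grp g ->
  sec1 g^-1 y = (sec1 g (y - shiftlab g)%R)^-1.
Proof.
move=> Hg; apply: (mulgI (sec1 g (y - shiftlab g)%R)); rewrite mulgV.
have := sec1M g^-1 (y - shiftlab g)%R Hg.
by rewrite mulgV sec11 subrK => <-.
Qed.

Lemma sec1_comm D (g h : aut (tree D)) y : grp g -> grp h ->
  shiftlab g = 0%R -> shiftlab h = 0%R ->
  sec1 [~ g, h] y = [~ sec1 g y, sec1 h y].
Proof.
move=> Hg Hh g0 h0; rewrite !commgEl !conjgE.
have Vg := grpV Hg; have Vh := grpV Hh.
by rewrite !sec1M ?shiftlabV ?g0 ?h0 ?oppr0 ?addr0 ?sec1V ?g0 ?h0 ?subr0 //;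
  rewrite oppr0 addr0 ?subr0.
Qed.

Lemma shiftlab_comm D (g h : aut (tree D)) : grp g -> grp h ->
  shiftlab [~ g, h] = 0%R.
Proof.
move=> Hg Hh; have Vg := grpV Hg; have Vh := grpV Hh.
rewrite commgEl conjgE !shiftlabM ?shiftlabV //; try by do ?apply: grpM.
by rewrite [(shiftlab g + _)%R]addrC addKr addNr.
Qed.

Lemma at1J D y k (g : aut (tree D)) : grp g ->
  at1 y k ^ g = @at1 (tree D) (y + shiftlab g)%R (k ^ sec1 g y).
Proof.
move=> Hg; have tg := shiftlabP Hg; rewrite conjgE; apply: (canLR (mulKg _)).
apply: autP => -[|z w]; first by rewrite !aut_root.
rewrite autME at1E !autME !tg at1E (inj_eq (addIr _)); congr Cons.
by case: eqP => [->|//]; rewrite conjgE !autME autKV.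
Qed.

Lemma ps_neq0 D i : admissible E D -> (i < npos (D 0))%N -> ps (D 0) i <> 0%R.
Proof. by move=> gD Hi i0; apply: (ps_sum gD Hi Hi Hi); rewrite i0 addr0. Qed.

Lemma dlab_ps D i k : admissible E D -> (i < npos (D 0))%N ->
  dlab k (ps (D 0) i) = @rooted (dshift 1 D) (gn (D 1) i *~ k)%R.
Proof.
move=> gD Hi; rewrite /dlab; case: eqP => [/(ps_neq0 gD Hi)//|_].
by have [j -> <-] := pos_ps gD Hi.
Qed.

(* The supports of b and of its conjugate by the i-th position share only the
   vertex 0, because the positions are sum-free. *)
Lemma at1_comm_dir_rooted D i k l : admissible E D -> (i < npos (D 0))%N ->
  @at1 (tree D) (0%R : lab (D 0))
    [~ dir (dshift 1 D) k, @rooted (dshift 1 D) (gn (D 1) i *~ l)%R] =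
  [~ dir D k, dir D l ^ rooted (- ps (D 0) i)%R].
Proof.
move=> gD Hi; set x := ps _ i.
have Gx := rooted_grp (- x)%R gD; have Gk := dir_grp D k.
have Gl := dir_grp D l; have Gc := grpJ Gl Gx.
have c0 : shiftlab (dir D l ^ rooted (- x)%R) = 0%R.
  rewrite conjgE !shiftlabM ?shiftlabV ?shiftlab_rooted ?shiftlab_dir //.
  - by rewrite add0r addNr.
  - exact: grpV.
  - exact: grpM.
apply: (@translates_ext _ 0%R); first exact: translates_at1.
  rewrite -(shiftlab_comm Gk Gc); apply: shiftlabP; exact: grp_comm.
move=> y; rewrite sec1_at1 sec1_comm ?shiftlab_dir // sec1_dir.
have -> : sec1 (dir D l ^ rooted (- x)%R) y = dlab l (y + x)%R.
  rewrite conjgE -rootedN opprK !sec1M ?shiftlab_rooted ?shiftlab_dir //; last exact: rooted_grp.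
  by rewrite !sec1_rooted mul1g mulg1 sec1_dir.
case: eqP => [->|y0]; first by rewrite add0r dlab_ps // /dlab eqxx.
have [Cy|/dlab_notcenter->] := pselect (center y); last by rewrite comm1g.
case: Cy => // -[j Hj yE].
rewrite [dlab l _]dlab_notcenter ?commg1 // => -[].
  by rewrite yE; apply: ps_sum0 gD _ _ _ Hj Hi.
by case=> m Hm; rewrite yE; apply: ps_sum gD _ _ _ _ Hj Hi Hm.
Qed.

(** Self-replication: at 0, [b] has the next [b] as section, and its conjugate by the inverse of the
    i-th position has the i-th generator of the next level. *)
Lemma lift_grp D (g : aut (tree (dshift 1 D))) : admissible E D ->
  @grp (dshift 1 D) g ->
  exists2 h : aut (tree D), grp h & shiftlab h = 0%R /\ sec1 h (0%R : lab (D 0)) = g.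
Proof.
move=> gD [n]; elim=> {n g}[|s g n Hs _ [h Hh [h0 hg]]].
  by exists 1; [apply: grp1 | rewrite shiftlab1 sec11].
have [t Ht [t0 tg]] : exists2 h : aut (tree D), grp h &
    shiftlab h = 0%R /\ sec1 h (0%R : lab (D 0)) = s.
  case: Hs => [i k Hi|k]; last first.
    by exists (dir D k); rewrite ?shiftlab_dir ?sec1_dir /dlab ?eqxx //; apply: dir_grp.
  rewrite /dshift /= -(npos_rk gD) in Hi.
  have Gx := rooted_grp (- ps (D 0) i)%R gD.
  exists (dir D k ^ rooted (- ps (D 0) i)%R); first exact: grpJ (dir_grp _ _) Gx.
  have Gk := dir_grp D k; have Gx' := rooted_grp (ps (D 0) i) gD.
  rewrite conjgE -rootedN opprK !shiftlabM ?sec1M ?shiftlab_rooted ?shiftlab_dir //;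
    try exact: grpM.
  split; first by rewrite add0r addrN.
  by rewrite !sec1_rooted sec1_dir mul1g mulg1 add0r dlab_ps.
exists (t * h); first exact: grpM.
by rewrite shiftlabM // t0 h0 addr0 sec1M // t0 addr0 tg hg.
Qed.

(** The elements whose copy at 0 is in [der] form a subgroup, normalised by the lower group because
    that group lifts to elements fixing the first level. It therefore suffices to treat commutators
    of letters; conjugation by a rooted element then moves 0 to [y]. *)
Lemma der_at1 D y k : admissible E D -> @der (dshift 1 D) k -> der (@at1 (tree D) y k).
Proof.
move=> gD Hk; have gD1 := admissible_shift 1 gD.
suff H0 : der (@at1 (tree D) (0%R : lab (D 0)) k).
  have := derJ (rooted_grp y gD) H0.
  by rewrite at1J ?shiftlab_rooted ?sec1_rooted ?conjg1 ?add0r //; apply: rooted_grp.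
pose N : set (aut (tree (dshift 1 D))) :=
  [set k | der (@at1 (tree D) (0%R : lab (D 0)) k)].
have NS : subgroup N.
  split=> [|g h|g]; rewrite /N /= ?at11 ?at1M ?at1V.
  - exact: der1.
  - exact: derM.
  - exact: derV.
have [N1 NM NV] := NS.
have NJ g h : @grp (dshift 1 D) h -> N g -> N (g ^ h).
  move=> /(lift_grp gD)[t Ht [t0 <-]] /(derJ Ht).
  by rewrite at1J // t0 addr0.
(* Two letters of the same kind commute, which leaves a power of [b] against a rooted letter. *)
have Ngen s t : @generator (dshift 1 D) s -> @generator (dshift 1 D) t -> N [~ s, t].
  have dr i m l : (i < rk (dshift 1 D 0))%N ->
    N [~ dir (dshift 1 D) m, @rooted (dshift 1 D) (gn (D 1) i *~ l)%R].
    rewrite /dshift /= -(npos_rk gD) => Hi.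
    rewrite /N /= at1_comm_dir_rooted //; apply: der_comm; first exact: dir_grp.
    exact: grpJ (dir_grp _ _) (rooted_grp _ gD).
  case=> [i m Hi|m]; case=> [j l Hj|l].
  - suff -> : [~ @rooted (dshift 1 D) (gn (D 1) i *~ m)%R,
        @rooted (dshift 1 D) (gn (D 1) j *~ l)%R] = 1 by [].
    by apply/eqP/commgP; rewrite /commute -!rootedD addrC.
  - by rewrite -invgR; apply: NV; apply: dr.
  - exact: dr.
  - suff -> : [~ dir (dshift 1 D) m, dir (dshift 1 D) l] = 1 by [].
    by apply/eqP/commgP; rewrite /commute -!dirD addrC.
have Ngl g t : @grp (dshift 1 D) g -> @generator (dshift 1 D) t -> N [~ g, t].
  case=> n Hg Ht; elim: Hg => [|s h l Hs Hh IH]; first by rewrite comm1g.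
  rewrite commMgJ; apply: NM => //; apply: NJ; first by exists l.
  exact: Ngen.
apply: (der_min (H := N)) Hk => // g h Hg [n].
elim=> [|s t l Hs Ht IH]; first by rewrite commg1.
rewrite commgMJ; apply: NM => //; apply: NJ; first by exists l.
exact: Ngl.
Qed.

Lemma rooted_eq1 D a : @rooted D a = 1 -> a = 0%R.
Proof. by move=> H; rewrite -(shiftlab_rooted a) H. Qed.

Lemma dir_neq1 D : admissible E D -> dir D 1 <> 1.
Proof.
move=> gD H; have [i Hi Hn] := gn_neq0 gD 1; apply: Hn.
rewrite -(npos_rk gD) in Hi.
have := congr1 (fun g : aut (tree D) => sec1 g (ps (D 0) i)) H.
by rewrite sec1_dir sec11 dlab_ps // mulr1z => /rooted_eq1.
Qed.

(** If [b] commuted with the rooted element of a label [a <> 0], comparing sections at 0 would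
    equate the next [b] with the section of [b] at [a], which is rooted or trivial; but [b] fixes
    the first level and is not 1. *)
Lemma der_neq1 D : admissible E D -> exists2 k : aut (tree D), der k & k <> 1.
Proof.
move=> gD; have [i Hi /eqP a0] := gn_neq0 gD 0; set a := gn _ i in a0.
have Ga := rooted_grp a gD; have Gd := dir_grp D 1.
exists [~ dir D 1, rooted a]; first exact: der_comm.
move=> /eqP/commgP /(congr1 (fun g : aut (tree D) => sec1 g (0%R : lab (D 0)))).
rewrite !sec1M // !sec1_dir !sec1_rooted shiftlab_rooted mulg1 mul1g add0r.
rewrite /dlab eqxx (negPf a0).
have gD1 := admissible_shift 1 gD.
case: pos => [j|]; last exact: dir_neq1.
move=> H; have c0 : (gn (D 1) j *~ 1 = 0 :> lab (D 1))%R.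
  have := congr1 (@shiftlab (dshift 1 D)) H.
  by rewrite shiftlab_dir shiftlab_rooted => ->.
by move: H; rewrite c0 (rooted0 (dshift 1 D)); apply: dir_neq1.
Qed.

(** Commuting with a nontrivial copy of [k] at [y] forces [z] to fix [y] and its section there to
    commute with [k]. The section thus centralises the next derived subgroup, and the argument
    descends along the vertex. *)
Lemma centralizer_der D (z : aut (tree D)) : admissible E D -> grp z ->
  (forall k, der k -> commute z k) -> z = 1.
Proof.
move=> gD Gz Cz; apply: autP => v; rewrite aut1E.
elim/tree_ind: D / v z gD Gz Cz => [D|D y w IH] z gD Gz Cz; first by rewrite aut_root.
have Hk k : @der (dshift 1 D) k -> k <> 1 ->
    shiftlab z = 0%R /\ commute (sec1 z y) k.
  move=> dk k1; have /commgP/conjg_fixP := commute_sym (Cz _ (der_at1 y gD dk)).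
  rewrite at1J //.
  have kz1 : k ^ sec1 z y <> 1 by move/eqP; rewrite conjg_eq1 => /eqP.
  case/at1_inj => // Ey /conjg_fixP/commgP Ek; split; last exact: commute_sym.
  by apply: (addrI y); rewrite addr0.
rewrite (shiftlabP Gz).
have [k dk k1] := der_neq1 (admissible_shift 1 gD).
have [-> _] := Hk k dk k1; rewrite addr0; congr Cons.
apply: IH; first exact: admissible_shift.
  by have [n Bn] := Gz; exists n; apply: ball_sec1 gD Bn.
move=> l dl; have [->|l1] := pselect (l = 1); first exact: commute1.
by have [] := Hk l dl l1.
Qed.

(** If a term of the lower central series is trivial, the preceding one is central, hence trivial by
    [centralizer_der]; descending, the whole group would be trivial. *)
Lemma not_nilpotent_grp D : admissible E D -> ~ nilpotent (@grp D).
Proof.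
move=> gD [c]; elim: c => [|c IH] Hc.
  have : grp (dir D 1) by apply: dir_grp.
  by rewrite -[@grp D]/(lower_central (@grp D) 0) Hc => /(dir_neq1 gD).
have subG := grp_subgroup D.
have [L1 _ _] := lower_central_subgroup c subG.
apply: IH; apply/seteqP; split=> [z Lz|_ -> //].
apply: centralizer_der => //; first exact: lower_central_sub Lz.
move=> k /der_grp Gk; apply/commgP/eqP.
have : lower_central (@grp D) c.+1 [~ z, k] by apply: generated_sub; exists z, k.
by rewrite Hc.
Qed.

Lemma transitive_grp D : admissible E D -> spherically_transitive (@grp D).
Proof.
move=> gD n; elim: n D gD => [|n IH] D gD u v.
  by exists 1; split; [apply: grp1 | rewrite !level0E aut1E].
have [[y [u' ->]] [z [v' ->]]] := (lconsP u, lconsP v).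
have [g [Gg gE]] := IH _ (admissible_shift 1 gD) u' v'.
have [h Hh [h0 hg]] := lift_grp gD Gg.
(* Move the first letter to 0, act on the rest through a lift, then move 0 to the first letter of
   the target. *)
exists (rooted (- y)%R * h * rooted z); split.
  by do ?apply: grpM => //; apply: rooted_grp.
rewrite !autME !val_lcons rootedE addrN (shiftlabP Hh) h0 hg addr0 rootedE add0r.
by congr Cons.
Qed.

End Branching.

(** * Rigid layer stabilisers and finite index *)

Fixpoint at_level n : forall (X : nat -> finType) (u : vertex X),
    aut (shift n X) -> aut X :=
  match n with
  | 0%N => fun X u k => k
  | n'.+1 => fun X u k => if u is Cons y u' then at1 y (@at_level n' _ u' k) else 1
  end.

Lemma at_level_lcons n (X : nat -> finType) (y : X 0) (u : level (shift 1 X) n)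
    (k : aut (shift n.+1 X)) :
  at_level (val (lcons y u)) k = at1 y (@at_level n (shift 1 X) (val u) k).
Proof. by []. Qed.

(** One collection step: moving [s] past [c] and [r] costs factors that stay in the derived subgroup
    when [c] does. *)
Lemma collect_swap (gT : groupType) (s c r b : gT) :
  s * (c * (r * b)) = c ^ s^-1 * [~ s^-1, r^-1] * (r * (s * b)).
Proof.
rewrite -[RHS]mulgA (mulgA r) (mulgA [~ _, _]) -commgCV.
by rewrite (mulgA s c) [s * c]conjgCV -!mulgA.
Qed.

Section RigidLayers.
Variable E : nat.

Lemma der_at_level D n (u : level (tree D) n) k : admissible E D ->
  @der (dshift n D) k -> der (@at_level n (tree D) (val u) k).
Proof.
elim: n D u k => [|n IH] D u k gD Hk //.
have [y [u' ->]] := lconsP u; rewrite at_level_lcons.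
by apply: (der_at1 y gD); apply: (IH (dshift 1 D)) Hk; apply: admissible_shift.
Qed.

Lemma level_aut_at_level (X : nat -> finType) n (u v : level X n) (k : aut (shift n X)) :
  level_aut (at_level (val u) k) v = v.
Proof.
apply: val_inj => /=; elim: n X u v k => [|n IH] X u v k; first by rewrite !level0E (aut_root k).
have [[y [u' ->]] [z [v' ->]]] := (lconsP u, lconsP v).
rewrite at_level_lcons !val_lcons at1E; congr Cons.
by case: eqP => // _; apply: IH.
Qed.

Lemma section_at_level (X : nat -> finType) n (u v : level X n) (k : aut (shift n X)) :
  v <> u -> section (at_level (val u) k) v = 1.
Proof.
elim: n X u v k => [|n IH] X u v k vu.
  by case: vu; apply: val_inj; rewrite !level0E.
move: vu; have [[y [u' ->]] [z [v' ->]]] := (lconsP u, lconsP v) => vu.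
rewrite section_lcons at_level_lcons sec1_at1.
case: eqP => [zy|_]; last exact: (section1 v').
by apply: (IH (shift 1 X)) => vu'; apply: vu; rewrite zy vu'.
Qed.

Lemma rigid_at_level D n (u : level (tree D) n) k : admissible E D ->
  @der (dshift n D) k ->
  rigid_stabiliser (@grp D) u (@at_level n (tree D) (val u) k).
Proof.
move=> gD Hk; split; last by move=> v /section_at_level.
split; first exact: der_grp (der_at_level u gD Hk).
by move=> v; rewrite -[LHS]/(val (level_aut _ v)) level_aut_at_level.
Qed.

(* The product over the n-th level of the derived subgroups placed at its
   vertices. *)
Fixpoint der_layer n : forall D, set (aut (tree D)) :=
  match n with
  | 0%N => der
  | n'.+1 => fun D => [set g | translates 0%R g /\
      forall y : lab (D 0), @der_layer n' (dshift 1 D) (sec1 g y)]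
  end.

Definition der_layer_gen n D : set (aut (tree D)) :=
  generated [set g | exists (u : level (tree D) n) k,
    @der (dshift n D) k /\ g = @at_level n (tree D) (val u) k].

Lemma der_layer_gen_subgroup n D : subgroup (@der_layer_gen n D).
Proof. exact: generated_subgroup. Qed.

Lemma at1_der_layer_gen n D (y : lab (D 0)) g :
  @der_layer_gen n (dshift 1 D) g -> der_layer_gen n.+1 (@at1 (tree D) y g).
Proof.
have [G1 GM GV] := der_layer_gen_subgroup n.+1 D.
apply: (generated_min (H := [set g | der_layer_gen n.+1 (@at1 (tree D) y g)])).
  split=> /= [|g1 g2|g1]; rewrite ?at11 ?at1M ?at1V; [exact: G1|exact: GM|exact: GV].
move=> _ [u [k [Hk ->]]]; apply: generated_sub.
by exists (@lcons (tree D) n y u), k.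
Qed.

(** The first level is finite: its sections are split off one vertex at a time, each as a factor
    [at1 y], by induction on a list [s] outside which the sections are trivial. *)
Lemma der_layer_sub n D : admissible E D -> @der_layer n D `<=` @der_layer_gen n D.
Proof.
elim: n D => [|n IH] D gD g.
  move=> Hg; apply: generated_sub.
  by exists (exist (fun v : vertex (tree D) => vsize v == 0%N) Root isT), g.
have [G1 GM GV] := der_layer_gen_subgroup n.+1 D.
case=> tg Hg.
have {Hg} Hg y : @der_layer_gen n (dshift 1 D) (sec1 g y).
  by apply: IH (Hg y); apply: admissible_shift.
suff H (s : seq (lab (D 0))) (h : aut (tree D)) : translates 0%R h ->
    (forall y, @der_layer_gen n (dshift 1 D) (sec1 h y)) ->
    (forall y, y \notin s -> sec1 h y = 1) -> der_layer_gen n.+1 h.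
  by apply: (H (enum (lab (D 0)))) => // y; rewrite mem_enum.
elim: s h => [|y s IHs] h th Hh sh.
  suff -> : h = 1 by apply: G1.
  apply: (translates_ext th) => [z w|z]; first by rewrite sec11 addr0.
  by rewrite sec11 sh.
pose h' := at1 y (sec1 h y)^-1 * h.
have -> : h = at1 y (sec1 h y) * h' by rewrite /h' at1V mulVKg.
have th' : translates 0%R h'.
  by rewrite -[0%R]addr0; apply: translatesM => //; apply: translates_at1.
have sh' z : sec1 h' z = if z == y then 1 else sec1 h z.
  apply: (@sec1_def _ _ _ z) => v; rewrite autME at1E th addr0.
  by case: eqP => [->|//]; rewrite autVK.
apply: GM; first exact: at1_der_layer_gen.
apply: IHs => // z; rewrite sh'.
  by case: eqP => // _; have [] := der_layer_gen_subgroup n (dshift 1 D).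
case: eqP => // zy zs.
by apply: sh; rewrite inE negb_or zs andbT; apply/eqP.
Qed.

Lemma der_layer_rigid n D : admissible E D ->
  @der_layer n D `<=` rigid_layer_stabiliser (@grp D) n.
Proof.
move=> gD g /(der_layer_sub gD); apply: generated_min.
  exact: generated_subgroup.
move=> _ [u [k [Hk ->]]]; apply: generated_sub; exists u => //.
exact: rigid_at_level.
Qed.

Lemma grp_mod_der D (g : aut (tree D)) : admissible E D -> grp g ->
  exists a k, der (g * (rooted a * dir D k)^-1).
Proof.
move=> gD [n]; elim=> [|s h l Hs Hh [a [k IH]]].
  by exists 0%R, 0%R; rewrite rooted0 dir0 mulg1 mulgV; apply: der1.
have Ga := rooted_grp a gD; have Gk := dir_grp D k.
have Gs := generator_grp Hs.
set c := h * _ in IH; have hE : h = c * (rooted a * dir D k) by rewrite mulgVK.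
rewrite hE.
have Hc : der (c ^ s^-1) by apply: derJ => //; apply: grpV.
case: Hs Gs Hc => [i m Hi|m] Gs Hc.
  exists (gn (D 0) i *~ m + a)%R, k.
  set r := rooted _ in Hc *; have -> : r * (c * (rooted a * dir D k)) =
    c ^ r^-1 * (rooted (gn (D 0) i *~ m + a)%R * dir D k).
    by rewrite rootedD -/r mulgA [r * c]conjgCV -!mulgA.
  by rewrite mulgK.
exists a, (m + k)%R.
rewrite collect_swap -dirD mulgK; apply: derM => //; apply: der_comm; exact: grpV.
Qed.

Definition mod_der_data D : finType := (lab (D 0) * 'I_E)%type.

Lemma grp_mod_der_fin D (g : aut (tree D)) : (0 < E)%N -> admissible E D -> grp g ->
  exists x : mod_der_data D, der (g * (rooted x.1 * dir D (x.2 : nat)%:Z)^-1).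
Proof.
move=> E0 gD /(grp_mod_der gD)[a [k Hk]].
have Ez : (E%:Z != 0)%R by rewrite -lt0n.
have k0 : (0 <= (k %% E)%Z)%R by apply: modz_ge0.
have kE : (`|(k %% E)%Z| < E)%N.
  by rewrite -ltz_nat gez0_abs // ltz_pmod.
exists (a, Ordinal kE) => /=; rewrite gez0_abs //.
suff -> : dir D (k %% E)%Z = dir D k by [].
have E2 : ((k %/ E)%Z * E%:Z = (k %/ E)%Z *+ E)%R by rewrite pmulrn mulrzz.
by have := dirD D ((k %/ E)%Z *+ E)%R (k %% E)%Z; rewrite dir_exp // mul1g -E2 -divz_eq.
Qed.

Fixpoint layer_data n : (nat -> datum) -> finType :=
  match n with
  | 0%N => mod_der_data
  | n'.+1 => fun D => (lab (D 0) * {ffun lab (D 0) -> layer_data n' (dshift 1 D)})%type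
  end.

(** The finite invariant [d] is a representative modulo the derived subgroup at depth 0, and
    otherwise the label together with the invariants of all first-level sections. It need not be a
    homomorphism: separating cosets is enough. *)
Lemma der_layer_index n D : (0 < E)%N -> admissible E D ->
  exists d : aut (tree D) -> layer_data n D, forall g h, grp g -> grp h ->
  d g = d h -> der_layer n (g * h^-1).
Proof.
move=> E0; elim: n D => [|n IH] D gD.
  have H (g : aut (tree D)) : exists x : mod_der_data D,
      grp g -> der (g * (rooted x.1 * dir D (x.2 : nat)%:Z)^-1).
    have [/(grp_mod_der_fin E0 gD)[x Hx]|no] := pselect (grp g); first by exists x.
    by exists (0%R, Ordinal E0) => /no.
  have [d Hd] := choice H; exists d => g h Gg Gh dgh.
  rewrite -[g](mulgVK (rooted (d g).1 * dir D (d g).2%:Z)) {3 4}dgh -mulgA.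
  apply: derM; first exact: Hd.
  by rewrite -invgF; apply: derV; apply: Hd.
have [d Hd] := IH _ (admissible_shift 1 gD).
exists (fun g => (shiftlab g, [ffun y => d (sec1 g y)])) => g h Gg Gh [sgh /ffunP dgh].
split.
  have -> : 0%R = (shiftlab g + - shiftlab h)%R by rewrite sgh addrN.
  by apply: translatesM; [apply: shiftlabP | rewrite -shiftlabV //; apply/shiftlabP/grpV].
move=> y; rewrite sec1M // sec1V // sgh addrK.
have := dgh y; rewrite !ffunE; apply: Hd.
  by have [l Bl] := Gg; exists l; apply: ball_sec1 gD Bl.
by have [l Bl] := Gh; exists l; apply: ball_sec1 gD Bl.
Qed.

Lemma branch_grp D : (0 < E)%N -> admissible E D -> branch (@grp D).
Proof.
move=> E0 gD; split; first exact: transitive_grp gD.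
move=> n; have [d Hd] := der_layer_index n E0 gD.
set H := rigid_layer_stabiliser _ _.
have [H1 HM HV] : subgroup H by apply: generated_subgroup.
(* Pick one group element for each value that [d] attains on the group, and the default 1 for the
   others; their cosets exhaust all cosets. *)
have rep (x : layer_data n D) : exists g, forall h, grp h -> d h = x -> grp g /\ d g = x.
  have [[g [Gg gx]]|no] := pselect (exists g, grp g /\ d g = x); first by exists g.
  by exists 1 => h Gh hx; case: no; exists h.
have [r Hr] := choice rep.
apply: (@sub_finite_set _ _ [set right_coset H (r x) | x in [set: layer_data n D]]).
  move=> _ [g Gg <-]; exists (d g) => //.
  have [Gr dr] := Hr _ _ Gg erefl.
  have Hrg : H (r (d g) * g^-1) by apply: (der_layer_rigid gD); apply: Hd.
  apply/seteqP; split=> _ [k Hk <-].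
    exists (k * (r (d g) * g^-1)); first exact: HM.
    by rewrite mulgA mulgVK.
  exists (k * (r (d g) * g^-1)^-1); first by apply: HM => //; apply: HV.
  by rewrite invgF -mulgA mulgVK.
exact/finite_image/finite_finset.
Qed.

End RigidLayers.

(** * An explicit example *)

Section Zp.
Local Open Scope ring_scope.

Lemma Zp_nat_inj Q a b : (1 < Q)%N -> (a < Q)%N -> (b < Q)%N ->
  a%:R = b%:R :> 'Z_Q -> a = b.
Proof.
by move=> Q1 aQ bQ /(congr1 val); rewrite /= !val_Zp_nat // !modn_small.
Qed.

Lemma Zp_mulrn Q (a : 'Z_Q) : (1 < Q)%N -> a *+ Q = 0.
Proof.
by move=> Q1; rewrite -[a]natr_Zp -mulrnA mulnC mulrnA pchar_Zp // mul0rn.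
Qed.

End Zp.

Section CyclicLevel.
Local Open Scope ring_scope.
Variables (Q N : nat).

(* The positions N, ..., 2N - 1 are sum-free modulo Q when Q > 4N. *)
Definition cyclic_datum : datum :=
  @Datum 'Z_Q 1 (fun=> 1) N (fun i => (N + i)%:R) (fun=> 0%N).

Hypothesis NQ : (4 * N < Q)%N.

Lemma cyclic_ps_inj i j : (i < N)%N -> (j < N)%N ->
  ps cyclic_datum i = ps cyclic_datum j -> i = j.
Proof. by move=> iN jN /Zp_nat_inj H; apply: (@addnI N); apply: H; lia. Qed.

Lemma cyclic_ps_sum0 i j : (i < N)%N -> (j < N)%N ->
  (ps cyclic_datum i + ps cyclic_datum j)%R <> 0.
Proof. by move=> iN jN; rewrite /= -natrD => /(@Zp_nat_inj _ _ 0); lia. Qed.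

Lemma cyclic_ps_sum i j k : (i < N)%N -> (j < N)%N -> (k < N)%N ->
  (ps cyclic_datum i + ps cyclic_datum j)%R <> ps cyclic_datum k.
Proof. by move=> iN jN kN; rewrite /= -natrD => /Zp_nat_inj; lia. Qed.

Lemma cyclic_gn_ind (P : lab cyclic_datum -> Prop) : P 0 ->
  (forall i k a, (i < rk cyclic_datum)%N -> P a -> P (gn cyclic_datum i *~ k + a)) ->
  forall a, P a.
Proof.
move=> P0 PS a.
have := PS 0%N (a : nat)%:Z 0 isT P0.
by rewrite addr0 -pmulrn /= natr_Zp.
Qed.

End CyclicLevel.

Section MatrixLevel.
Local Open Scope ring_scope.
Variables (q m j N : nat).

Definition code (i : nat) : {ffun 'I_j -> bool} :=
  nth [ffun=> false] (enum {: {ffun 'I_j -> bool}}) i.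

(* Every row of the i-th position is (1, code i): the leading 1 makes the
   positions sum-free (1 + 1 is neither 0 nor 1 modulo q > 2), the repetition of
   the row makes them far apart when the length counts nonzero rows. *)
Definition matrix_datum : datum :=
  @Datum 'M['Z_q]_(m.+1, j.+1) (m.+1 * j.+1)
    (fun i => delta_mx (inord (i %/ j.+1)) (inord (i %% j.+1))) N
    (fun i => \matrix_(l, t) (if unlift ord0 t is Some s then (code i s : nat)%:R else 1))
    (fun a => #|[set l | row l a != 0]%SET|).

Hypothesis q2 : (2 < q)%N.
Notation P := (ps matrix_datum).

Lemma Zq1_neq0 : 1 != 0 :> 'Z_q.
Proof. by apply/eqP => /(@Zp_nat_inj q 1 0); lia. Qed.

Lemma code_inj i k : (N <= 2 ^ j)%N -> (i < N)%N -> (k < N)%N -> code i = code k -> i = k.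
Proof.
move=> NJ iN kN /eqP; rewrite nth_uniq ?enum_uniq // -?cardE ?card_ffun ?card_bool ?card_ord.
- by move/eqP.
- exact: leq_trans iN NJ.
- exact: leq_trans kN NJ.
Qed.

Lemma psE0 i l : P i l ord0 = 1.
Proof. by rewrite mxE unlift_none. Qed.

Lemma psES i l s : P i l (lift ord0 s) = (code i s : nat)%:R.
Proof. by rewrite mxE liftK. Qed.

Lemma matrix_ps_code i k s : (code i s : nat)%:R = (code k s : nat)%:R :> 'Z_q ->
  code i s = code k s.
Proof. by case: (code i s); case: (code k s) => // /Zp_nat_inj; lia. Qed.

Lemma matrix_ps_inj i k : (N <= 2 ^ j)%N -> (i < N)%N -> (k < N)%N -> P i = P k -> i = k.
Proof.
move=> NJ iN kN E; apply: code_inj => //; apply/ffunP => s.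
by apply: matrix_ps_code; rewrite -!(psES _ ord0) E.
Qed.

Lemma matrix_ps_sum0 i k : P i + P k <> 0.
Proof.
move=> /matrixP/(_ ord0 ord0); rewrite [LHS]mxE !psE0 mxE.
by rewrite -(natrD _ 1 1) => /(@Zp_nat_inj q 2 0); lia.
Qed.

Lemma matrix_ps_sum i k l : P i + P k <> P l.
Proof.
move=> /matrixP/(_ ord0 ord0); rewrite [LHS]mxE !psE0.
by rewrite -(natrD _ 1 1) => /(@Zp_nat_inj q 2 1); lia.
Qed.

Lemma matrix_gn_ind (H : lab matrix_datum -> Prop) : H 0 ->
  (forall i k a, (i < rk matrix_datum)%N -> H a -> H (gn matrix_datum i *~ k + a)) ->
  forall a, H a.
Proof.
move=> H0 HS a; rewrite (matrix_sum_delta a) pair_big /=.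
elim: (index_enum _) => [|[l t] s IH]; first by rewrite big_nil.
(* The entry in row [l] and column [t] belongs to the generator numbered [l * j.+1 + t]. *)
rewrite big_cons /=.
have lt : (l * j.+1 + t < m.+1 * j.+1)%N.
  by have := ltn_ord l; have := ltn_ord t; nia.
have := HS _ (a l t : nat)%:Z _ lt IH; congr (H (_ + _)).
rewrite /= divnMDl // divn_small ?addn0 ?ltn_ord // modnMDl modn_small ?ltn_ord //.
rewrite !inord_val -pmulrn -scaler_nat; congr (_ *: _).
exact: natr_Zp.
Qed.

Lemma matrix_gn_neq0 : gn matrix_datum 0 <> 0.
Proof.
move=> /matrixP/(_ (inord (0 %/ j.+1)) (inord (0 %% j.+1))).
by rewrite !mxE !eqxx => /eqP; rewrite (negPf Zq1_neq0).
Qed.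

Lemma matrix_exp (a : lab matrix_datum) : a *+ q = 0.
Proof.
apply/matrixP => l t; rewrite mulmxnE mxE.
by apply: Zp_mulrn; lia.
Qed.

Lemma matrix_nrm0 : nrm (0 : lab matrix_datum) = 0%N.
Proof. by apply/eqP; rewrite cards_eq0; apply/eqP/setP => l; rewrite !inE row0 eqxx. Qed.

Lemma matrix_nrmD (a b : lab matrix_datum) : (nrm (a + b)%R <= nrm a + nrm b)%N.
Proof.
pose S (c : lab matrix_datum) := [set l | row l c != 0]%SET.
apply: (@leq_trans #|S a :|: S b|); last exact: leq_card_setU.
apply/subset_leq_card/fintype.subsetP => l.
rewrite !inE -negb_and; apply: contraNN => /andP[/eqP al /eqP bl].
by rewrite linearD /= al bl addr0.
Qed.

Lemma matrix_nrmN (a : lab matrix_datum) : nrm (- a) = nrm a.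
Proof. by apply: eq_card => l; rewrite !inE linearN oppr_eq0. Qed.

Lemma matrix_nrm_gn i k : (nrm (gn matrix_datum i *~ k)%R <= 1)%N.
Proof.
rewrite -(cards1 (inord (i %/ j.+1) : 'I_m.+1)).
apply/subset_leq_card/fintype.subsetP => l; rewrite !inE; apply: contraNT => /negPf nl.
apply/eqP/rowP => t; rewrite !mxE.
suff -> : (gn matrix_datum i *~ k) l t = (gn matrix_datum i) l t *~ k.
  by rewrite mxE nl mul0rz.
by case: k => k; rewrite ?NegzE ?mulrNz -!pmulrn ?[LHS]mxE mulmxnE.
Qed.

(** All rows of a position are equal, so codes that differ in one bit make every one of the [m.+1]
    rows of the difference nonzero. *)
Lemma matrix_separated i k : (N <= 2 ^ j)%N -> (i < N)%N -> (k < N)%N ->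
  (nrm (P i - P k)%R <= m)%N ->
  i = k.
Proof.
move=> NJ iN kN; rewrite leqNgt => small; apply: code_inj => //; apply/ffunP => s.
apply: matrix_ps_code; apply/eqP; apply: contraNT small => ns.
rewrite -[X in (X <= _)%N](card_ord m.+1) -cardsT; apply/subset_leq_card/fintype.subsetP => l _.
rewrite inE; apply/eqP => /rowP/(_ (lift ord0 s)).
rewrite mxE [LHS]mxE [X in _ + X]mxE !psES mxE => /eqP.
by rewrite subr_eq0 (negPf ns).
Qed.

(** The leading 1 makes every row nonzero. *)
Lemma matrix_separated0 i : (m < nrm (P i))%N.
Proof.
rewrite -[X in (X <= _)%N](card_ord m.+1) -cardsT; apply/subset_leq_card/fintype.subsetP => l _.
rewrite inE; apply/eqP => /rowP/(_ ord0).
by rewrite mxE psE0 mxE => /eqP; rewrite (negPf Zq1_neq0).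
Qed.

End MatrixLevel.

(** * Growth of the parameters *)

Section Growth.
Local Open Scope nat_scope.

(* The matrices of level n+1 repeat a binary code of length [codelen n] on
   [copies n] + 1 rows; the code must have a word for each of the [rank n.+1]
   generators of the following level. *)
Definition copies (n : nat) : nat := 2 ^ (2 ^ (n ^ 3)).
Definition codelen (n : nat) : nat := 2 ^ (n.+1 ^ 3) + (n.+2 ^ 3 + 3).
Definition rank (n : nat) : nat := (copies n).+1 * (codelen n).+1.

(** [2 ^ codelen n] is [copies n.+1] times [2 ^ (n.+2 ^ 3 + 3)]: the first summand of [codelen] pays
    for the rows, the second for the columns of the next matrices. *)
Lemma rank_codelen n : rank n.+1 <= 2 ^ codelen n.
Proof.
rewrite /rank /codelen expnD mulnC; set a := n.+2 ^ 3.
have a8 : 8 <= a by rewrite /a -[8]/(2 ^ 3) leq_exp2r.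
apply: (@leq_trans (2 ^ (a + 2) * (2 * copies n.+1))).
  apply: leq_mul; last first.
    have : 0 < copies n.+1 by rewrite expn_gt0.
    lia.
  have cube : n.+3 ^ 3 + 4 <= 3 * 2 ^ a.
    have : a < 2 ^ a by apply: ltn_expl.
    have : 4 * 2 ^ (a - 2) = 2 ^ a by rewrite -(expnD 2 2); congr (2 ^ _); lia.
    have : a - 2 < 2 ^ (a - 2) by apply: ltn_expl.
    rewrite /a !expnS expn0 !muln1; nia.
  by rewrite expnD; move: cube; lia.
rewrite mulnA -expnSr mulnC leq_mul2l; apply/orP; right.
by rewrite leq_exp2l //; lia.
Qed.

Variables (p T : nat).
Hypothesis p0 : 0 < p.

Lemma depth_comm_leq n : depth_comm p T n <= T * n * (p ^ T) ^ n.
Proof.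
elim: n => [|n IH] //=.
have E0 : 0 < p ^ T by rewrite expn_gt0 p0.
have le : (p ^ T) ^ n <= (p ^ T) ^ n.+1 by rewrite leq_pexp2l.
apply: (@leq_trans (T * n * (p ^ T) ^ n.+1 + T * (p ^ T) ^ n.+1)).
  by apply: leq_add; [apply: leq_trans IH _|]; rewrite leq_mul2l le orbT.
by rewrite -mulnDl -mulnSr.
Qed.

(** [depth_comm] is at most 2 to a quadratic power of [n], so [4 ^ depth_comm] is doubly exponential
    with a quadratic exponent, while [copies] has a cubic one. The index [n.+2] appears because the
    matrices with [copies n] sit at level n+1. *)
Lemma copies_large l : exists n,
  2 * ((p ^ T) ^ n.+2 * l + 4 ^ depth_comm p T n.+2 * l) <= copies n.
Proof.
(* The summand [p * T] gives [p ^ T <= 2 ^ n], [T] and [l] are absorbed as factors, and 10 makes the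
   cubic exponent dominate. *)
pose n := p * T + T + l + 10; exists n.
have En : p ^ T <= 2 ^ n.
  apply: (@leq_trans (2 ^ (p * T))); last by rewrite leq_exp2l // /n; lia.
  by rewrite expnM; case: T => // t; rewrite leq_exp2r //; apply/ltnW/ltn_expl.
pose d := n * n.+2.
have Ed : (p ^ T) ^ n.+2 <= 2 ^ d by rewrite /d expnM leq_exp2r.
have dd : d < 2 ^ d by apply: ltn_expl.
have D1 : depth_comm p T n.+2 <= 2 ^ (2 * d).
  apply: leq_trans (depth_comm_leq _) _.
  rewrite mul2n -addnn expnD; apply: leq_mul => //.
  by apply: leq_trans (ltnW dd); rewrite leq_mul2r /n; apply/orP; right; lia.
pose X := 2 ^ (2 * d).
have dX : d <= X by apply: leq_trans (ltnW dd) _; rewrite leq_exp2l //; lia.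
have lX : l < 2 ^ X.
  apply: (@leq_ltn_trans d); last by apply: leq_ltn_trans dX (ltn_expl _ _).
  by rewrite /d /n; nia.
have F : 4 ^ depth_comm p T n.+2 <= 2 ^ (2 * X).
  by rewrite (expnM 2 2 X) leq_exp2l.
have G : (p ^ T) ^ n.+2 <= 2 ^ (2 * X).
  by apply: leq_trans Ed _; rewrite leq_exp2l //; lia.
apply: (@leq_trans (2 ^ (2 + 2 * X + X))).
  rewrite (expnD 2 (2 + 2 * X) X) (expnD 2 2 (2 * X)) -mulnDl; move: F G lX.
  move: (2 ^ (2 * X)) (2 ^ X) (4 ^ _) ((p ^ T) ^ _) => a b c e ca ea lb.
  rewrite mulnA; apply: leq_mul; last exact: ltnW.
  by rewrite (_ : 2 ^ 2 = 4) //; lia.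
rewrite /copies leq_exp2l //.
apply: (@leq_trans (2 ^ (2 * d + 3))).
  have X0 : 0 < X by rewrite expn_gt0.
  by rewrite expnD -/X (_ : 2 ^ 3 = 8) //; lia.
rewrite leq_exp2l // /d; have : 10 <= n by rewrite /n; lia.
by rewrite !expnS expn0 muln1; nia.
Qed.
End Growth.

Section Example.
Local Open Scope nat_scope.
Variables (p T : nat).
Hypotheses (pp : prime p) (T2 : 2 <= T) (TN : 4 * rank 0 < p ^ T).

(** The modulus [p ^ 2] exceeds 2 even for [p = 2], as the sum-freeness of the matrix positions
    requires. *)
Definition example (n : nat) : datum :=
  if n is n'.+1 then matrix_datum (p ^ 2) (copies n') (codelen n') (rank n)
  else cyclic_datum (p ^ T) (rank 0).

Let q2 : 2 < p ^ 2.
Proof. by have := prime_gt1 pp; rewrite !expnS expn0; nia. Qed.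

Let rank0 : 0 < rank 0. Proof. by []. Qed.

Lemma admissible_example : admissible (p ^ T) example.
Proof.
have Q1 : 1 < p ^ T by have := rank0; lia.
split.
- by case.
- case=> [|n] i j; first exact: (cyclic_ps_inj TN).
  by apply: matrix_ps_inj => //; apply: rank_codelen.
- case=> [|n] i j; first exact: (cyclic_ps_sum0 TN).
  by move=> _ _; apply: matrix_ps_sum0.
- case=> [|n] i j k; first exact: (cyclic_ps_sum TN).
  by move=> _ _ _; apply: matrix_ps_sum.
- case=> [|n]; [exact: cyclic_gn_ind | exact: matrix_gn_ind].
- case=> [|n]; exists 0 => //; last exact: matrix_gn_neq0.
- case=> [|n] a; first exact: Zp_mulrn.
  by rewrite -(subnKC T2) expnD mulrnA matrix_exp // mul0rn.
- by case=> [|n]; last exact: matrix_nrm0.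
- by case=> [|n] a b; last exact: matrix_nrmD.
- by case=> [|n] a; last exact: matrix_nrmN.
- by case=> [|n] i k _; last exact: matrix_nrm_gn.
Qed.

(** The index starts at [n.+1] because lengths on the cyclic level 0 are all zero. *)
Lemma example_separated n M : 2 * M <= copies n -> separated (dshift n.+1 example) M.
Proof.
rewrite mul2n /separated /center /dshift addn0 => leM.
move=> y z [->|[i Hi ->]] [->|[k Hk ->]] // /leq_trans/(_ leM).
- by rewrite sub0r matrix_nrmN leqNgt matrix_separated0.
- by rewrite subr0 leqNgt matrix_separated0.
- by move/(matrix_separated (rank_codelen n) Hi Hk) => ->.
Qed.

End Example.

(** * Subgroups as groups *)

Section SubgroupType.
Variables (gT : groupType) (G : set gT).
Hypothesis subG : subgroup G.

(** The proof is an argument of the type, so that the group structure can be inferred from the type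
    alone. *)
Definition subgroup_type (_ : subgroup G) : Type := {x : gT | G x}.
Local Notation H := (subgroup_type subG).

HB.instance Definition _ := gen_eqMixin H.
HB.instance Definition _ := gen_choiceMixin H.

Definition subgroup_one : H := let: And3 G1 _ _ := subG in exist _ 1 G1.
Definition subgroup_mul (x y : H) : H :=
  let: And3 _ GM _ := subG in exist _ (sval x * sval y) (GM _ _ (svalP x) (svalP y)).
Definition subgroup_inv (x : H) : H :=
  let: And3 _ _ GV := subG in exist _ (sval x)^-1 (GV _ (svalP x)).

Lemma subgroup_type_inj : injective (fun x : H => sval x).
Proof. by case=> x Gx [y Gy] /= xy; subst y; congr exist; apply: Prop_irrelevance. Qed.

Lemma sval_one : sval subgroup_one = 1.
Proof. by rewrite /subgroup_one; case: subG. Qed.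

Lemma sval_mul x y : sval (subgroup_mul x y) = sval x * sval y.
Proof. by rewrite /subgroup_mul; case: subG. Qed.

Lemma sval_inv x : sval (subgroup_inv x) = (sval x)^-1.
Proof. by rewrite /subgroup_inv; case: subG. Qed.

Fact subgroup_mulA : associative subgroup_mul.
Proof. by move=> x y z; apply: subgroup_type_inj; rewrite !sval_mul mulgA. Qed.
Fact subgroup_mul1g : left_id subgroup_one subgroup_mul.
Proof. by move=> x; apply: subgroup_type_inj; rewrite sval_mul sval_one mul1g. Qed.
Fact subgroup_mulg1 : right_id subgroup_one subgroup_mul.
Proof. by move=> x; apply: subgroup_type_inj; rewrite sval_mul sval_one mulg1. Qed.
Fact subgroup_mulVg : left_inverse subgroup_one subgroup_inv subgroup_mul.
Proof.
by move=> x; apply: subgroup_type_inj; rewrite sval_mul sval_one sval_inv mulVg.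
Qed.
Fact subgroup_mulgV : right_inverse subgroup_one subgroup_inv subgroup_mul.
Proof.
by move=> x; apply: subgroup_type_inj; rewrite sval_mul sval_one sval_inv mulgV.
Qed.

HB.instance Definition _ := isGroup.Build H subgroup_mulA subgroup_mul1g
  subgroup_mulg1 subgroup_mulVg subgroup_mulgV.

Lemma sval1 : sval (1 : H) = 1. Proof. exact: sval_one. Qed.
Lemma svalM (x y : H) : sval (x * y) = sval x * sval y. Proof. exact: sval_mul. Qed.
Lemma svalV (x : H) : sval x^-1 = (sval x)^-1. Proof. exact: sval_inv. Qed.

Lemma svalR (x y : H) : sval [~ x, y] = [~ sval x, sval y].
Proof. by rewrite !commgEl !conjgE !svalM !svalV. Qed.

Lemma subgroup_embeds : embeds G H.
Proof.
exists (fun x : gT => if pselect (G x) is left Gx then (exist _ x Gx : H) else (1 : H)).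
have [_ GM _] := subG.
split=> x y Gx Gy.
  case: pselect => [Gxy|no]; last by case: no; apply: GM.
  case: pselect => // Gx'; case: pselect => // Gy'.
  by apply: subgroup_type_inj; rewrite svalM.
by case: pselect => // Gx'; case: pselect => // Gy' [].
Qed.

Lemma subgroup_generated (S : set H) (x : H) :
  generated [set sval y | y in S] (sval x) -> generated S x.
Proof.
have [S1 SM SV] := generated_subgroup S.
suff sub : generated [set sval y | y in S] `<=` [set sval y | y in generated S].
  by move=> /sub[y Sy /subgroup_type_inj <-].
apply: generated_min => [|_ [y Sy <-]]; last by exists y => //; apply: generated_sub.
split=> [|_ _ [y Sy <-] [z Sz <-]|_ [y Sy <-]].
- by exists 1; rewrite ?sval1.
- by exists (y * z); [apply: SM | rewrite svalM].
- by exists y^-1; [apply: SV | rewrite svalV].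
Qed.

Lemma subgroup_Engel : Engel G -> Engel [set: H].
Proof.
move=> EG x y _ _; have [n Hn] := EG _ _ (svalP x) (svalP y); exists n.
apply: subgroup_type_inj; rewrite sval1 -Hn.
by elim: n {Hn} => //= n IH; rewrite svalR IH.
Qed.

Lemma subgroup_lower_central n (x : H) :
  lower_central G n (sval x) -> lower_central [set: H] n x.
Proof.
elim: n x => // n IH x /= Lx; apply: subgroup_generated.
have sub := lower_central_sub (n := n) subG.
apply: generated_min Lx; first exact: generated_subgroup.
move=> _ [g [h [Lg Gh ->]]]; apply: generated_sub.
exists [~ (exist _ g (sub _ Lg) : H), exist _ h Gh]; last by rewrite svalR.
by exists (exist _ g (sub _ Lg)), (exist _ h Gh); split=> //; apply: IH.
Qed.

Lemma subgroup_nilpotent : nilpotent [set: H] -> nilpotent G.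
Proof.
case=> c Hc; exists c; apply/seteqP; split=> [g Lg|_ ->].
  have Gg : G g by apply: lower_central_sub Lg.
  have : lower_central [set: H] c (exist _ g Gg) by apply: subgroup_lower_central.
  by rewrite Hc => /(congr1 (fun x : H => sval x)); rewrite sval1.
by have [] := lower_central_subgroup c subG.
Qed.

End SubgroupType.

Lemma two_generated_subgroup_type (gT : groupType) (a b : gT) (G : set gT)
    (subG : subgroup G) : G = generated [set a; b] ->
  two_generated [set: subgroup_type subG].
Proof.
move=> GE.
have Ga : G a by rewrite GE; apply: generated_sub; left.
have Gb : G b by rewrite GE; apply: generated_sub; right.
exists (exist _ a Ga), (exist _ b Gb); apply/seteqP; split=> // x _.
have : generated [set a; b] (sval x) by rewrite -GE; apply: svalP.
move=> gx; apply: subgroup_generated; move: gx.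
apply: generated_min; first exact: generated_subgroup.
move=> _ [->|->]; apply: generated_sub.
  by exists (exist _ a Ga) => //; left.
by exists (exist _ b Gb) => //; right.
Qed.

Lemma is_order_exists (gT : groupType) (p N : nat) (g : gT) : prime p ->
  g ^+ (p ^ N) = 1 -> exists k, is_order g (p ^ k)%N.
Proof.
move=> pp gN.
have ex : exists m, (0 < m)%N && (g ^+ m == 1).
  by exists (p ^ N)%N; rewrite expn_gt0 prime_gt0 // gN eqxx.
have [m /andP[m0 /eqP gm] min] := ex_minnP ex.
have dv : (m %| p ^ N)%N.
  have r1 : g ^+ (p ^ N %% m) = 1.
    move: gN; rewrite {1}(divn_eq (p ^ N) m) expgnDr mulnC expgnA gm expg1n.
    by rewrite mul1g.
  have [r0|r0] := posnP (p ^ N %% m); first by rewrite /dvdn r0.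
  by have := min (p ^ N %% m)%N; rewrite r0 r1 eqxx leqNgt ltn_pmod // => /(_ isT).
have /dvdn_pfactor[//|k _ mE] := dv.
exists k; rewrite -mE; split=> // n n0 gn.
by apply: min; rewrite n0 gn eqxx.
Qed.

Lemma grp_two_generated D : rk (D 0) = 1%N ->
  @grp D = generated [set rooted (gn (D 0) 0); dir D 1].
Proof.
move=> rk1; set S := [set _; _].
have [S1 SM SV] := generated_subgroup S.
apply/seteqP; split=> [g [n]|]; last first.
  apply: generated_min; first exact: grp_subgroup.
  move=> _ [->|->]; apply: generator_grp; last exact: GenDir.
  by rewrite -[gn _ _]mulr1z; apply: GenRooted; rewrite rk1.
elim=> {n g}[//|s g n Hs _ IH]; apply: (SM) => //.
(* Letters are arbitrary integer powers; each is recovered from the first power. *)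
have powers (z : int -> aut (tree D)) : (forall k l, z (k + l)%R = z k * z l) ->
    generated S (z 1%R) -> forall k, generated S (z k).
  move=> zD z1.
  have z0 : z 0%R = 1 by apply: (mulgI (z 0%R)); rewrite -zD addr0 mulg1.
  have zn (k : nat) : generated S (z k%:Z%R).
    elim: k => [|k IHk]; first by rewrite z0.
    by rewrite intS zD; apply: (SM).
  case=> k; first exact: zn.
  have -> : z (Negz k) = (z k.+1%:Z%R)^-1.
    by apply: (mulgI (z k.+1%:Z%R)); rewrite -zD NegzE addrN z0 mulgV.
  by apply: (SV).
case: Hs => [i k Hi|k].
  have -> : i = 0%N by move: Hi; rewrite rk1; case: i.
  apply: (powers (fun k => rooted (gn (D 0) 0 *~ k)%R)) => [a b|].
    by rewrite mulrzDr rootedD.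
  by rewrite mulr1z; apply: generated_sub; left.
apply: (powers (dir D)); first exact: dirD.
by apply: generated_sub; right.
Qed.

(** * The Engel and torsion properties of the example, and the theorem *)

Section ExampleGroup.
Variables (p T : nat).
Hypotheses (pp : prime p) (T2 : (2 <= T)%N) (TN : (4 * rank 0 < p ^ T)%N).
Local Notation D := (example p T).

Lemma example_Engel : Engel (@grp D).
Proof.
move=> g h [l Bg] [m Bh].
have [n Hn] := copies_large T (prime_gt0 pp) (l + m).
have gD := admissible_example pp T2 TN.
exists (depth_comm p T n.+2 + T * (p ^ T) ^ n.+2)%N.
have sep := example_separated pp T2 TN Hn.
have {}Bg : ball (l + m) g by apply: ballW Bg; rewrite leq_addr.
have {}Bh : ball (l + m) h by apply: ballW Bh; rewrite leq_addl.
exact: Engel_ball gD Bg Bh sep (leqnn _).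
Qed.

Lemma example_p_group : p_group p (@grp D).
Proof.
move=> g [l Bg].
have [n Hn] := copies_large T (prime_gt0 pp) l.
have gD := admissible_example pp T2 TN.
apply: (@is_order_exists _ p (T * n.+3)) => //; rewrite expnM.
apply: (torsion_ball gD Bg (example_separated pp T2 TN Hn)).
exact: leq_addr.
Qed.

End ExampleGroup.

Theorem theorem1p1 (p : nat) (hp : prime p) :
  exists (X : nat -> finType) (G : set (aut X)),
    (forall n : nat, (2 <= #|X n|)%N) /\
    [/\ subgroup G,
        finitely_generated G,
        Engel G,
        branch G &
        p_group p G] /\
    ~ nilpotent G /\
    (odd p ->
     exists H : groupType,
       [/\ embeds G H,
           two_generated [set: H]%classic,
           ~ nilpotent [set: H]%classic &
           Engel [set: H]%classic]).
Proof.
(* Since [T < p ^ T], this makes the cyclic level large enough for [rank 0] sum-free positions. *)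
pose T := (4 * rank 0).+2.
have T2 : (2 <= T)%N by [].
have TN : (4 * rank 0 < p ^ T)%N.
  apply: ltn_trans (ltn_expl T (prime_gt1 hp)); exact: leqnSn.
have gD := admissible_example hp T2 TN.
have GE := grp_two_generated (D := example p T) erefl.
have Gnil := not_nilpotent_grp gD.
have GEngel := example_Engel hp T2 TN.
exists (tree (example p T)), (@grp (example p T)); split; [|split; [split|split]].
(* Zero and a nonzero generator are two distinct letters. *)
- move=> n; have [i _ gi] := gn_neq0 gD n.
  rewrite -[2%N]/(true.+1) ltnNge; apply/negP => /card_le1_eqP H.
  exact: gi (H _ _ isT isT).
- exact: grp_subgroup.
- exists [:: rooted (gn (example p T 0) 0); dir (example p T) 1].
  rewrite GE; congr generated; apply/seteqP; split=> g /=.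
    by case=> ->; rewrite !inE eqxx ?orbT.
  by rewrite !inE => /orP[/eqP->|/eqP->]; [left|right].
- exact: GEngel.
- apply: (branch_grp (E := (p ^ T)%N)) => //.
  by rewrite expn_gt0 prime_gt0.
- exact: example_p_group hp T2 TN.
- exact: Gnil.
move=> _; exists (subgroup_type (grp_subgroup (example p T))); split.
- exact: subgroup_embeds.
- exact: two_generated_subgroup_type GE.
- by move/subgroup_nilpotent.
- exact: subgroup_Engel.
Qed.
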